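(* Let $\kappa$ be a Ramsey cardinal. Then $\kappa$ is unfoldable.
   Context: $\mathcal{R}(\kappa)=V_\kappa$ is the set of all sets of rank less than $\kappa$. For structures $\mathfrak{A}=(M,E,\dots)$ and $\mathfrak{B}=(N,F,\dots)$ in the same language, $\mathfrak{B}$ is an end elementary extension (eee) of $\mathfrak{A}$, written $\mathfrak{A}\prec_e\mathfrak{B}$, if $\mathfrak{B}$ is a proper elementary extension of $\mathfrak{A}$ and for every $a\in M$, $\{b\in M : bEa\}=\{b\in N: bFa\}$. $o(M)$ denotes the ordinal height of $M$. A cardinal $\kappa$ is unfoldable if it is inaccessible and for every ordinal $\alpha$ and every $S\subset\mathcal{R}(\kappa)$ there is a well-founded eee $M$ of $(\mathcal{R}(\kappa),\in,S)$ with $o(M)\geq\alpha$. *)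

(* Defs.v *)
From Stdlib Require Import Classical ClassicalEpsilon FunctionalExtensionality
  PropExtensionality ProofIrrelevance.

Set Implicit Arguments.
Unset Strict Implicit.

(** The ambient universe of set theory is Aczel's type of well-founded trees,
    quotiented by extensional equality so that [=] is equality of sets.  With
    classical logic and choice it is a model of ZFC with full (second-order)
    separation and replacement; see the lemmas [V_...] below.  Consequently a
    class function [V -> V] restricted to a set always is a set, and functions
    between sets are represented by class functions. *)

Inductive Ens : Type := sup (A : Type) (f : A -> Ens).

Definition idx (x : Ens) : Type := match x with @sup A _ => A end.
Definition elt (x : Ens) : idx x -> Ens :=
  match x return idx x -> Ens with @sup _ f => f end.

Fixpoint eqE (x y : Ens) : Prop :=
  match x, y with
  | @sup A f, @sup B g =>
      (forall a, exists b, eqE (f a) (g b)) /\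
      (forall b, exists a, eqE (f a) (g b))
  end.

Definition inE (x y : Ens) : Prop := exists i : idx y, eqE x (elt i).

Definition V : Type := {P : Ens -> Prop | exists x, P = eqE x}.
Definition cls (x : Ens) : V := exist _ (eqE x) (ex_intro _ x eq_refl).
Definition repr (X : V) : Ens :=
  proj1_sig (constructive_indefinite_description _ (proj2_sig X)).

Definition mem (X Y : V) : Prop := inE (repr X) (repr Y).
Definition sub (X Y : V) : Prop := forall z, mem z X -> mem z Y.
Notation "x ∈ y" := (mem x y) (at level 70).
Notation "x ⊆ y" := (sub x y) (at level 70).

Definition is_set (P : V -> Prop) : Prop := exists X, forall z, z ∈ X <-> P z.

Lemma eqE_refl x : eqE x x.
Proof. induction x as [A f IH]; split; intros a; exists a; apply IH. Qed.

Lemma eqE_sym x y : eqE x y -> eqE y x.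
Proof.
revert y; induction x as [A f IH]; intros [B g] [H1 H2]; split.
- intros b; destruct (H2 b) as [a H]; exists a; auto.
- intros a; destruct (H1 a) as [b H]; exists b; auto.
Qed.

Lemma eqE_trans x y z : eqE x y -> eqE y z -> eqE x z.
Proof.
revert y z; induction x as [A f IH]; intros [B g] [C h] [H1 H2] [H3 H4]; split.
- intros a; destruct (H1 a) as [b H]; destruct (H3 b) as [c H']; exists c; eauto.
- intros c; destruct (H4 c) as [b H]; destruct (H2 b) as [a H']; exists a; eauto.
Qed.

Lemma cls_eq x y : cls x = cls y <-> eqE x y.
Proof.
split.
- intros H; change (proj1_sig (cls x) y); rewrite H; apply eqE_refl.
- intros H; apply subset_eq_compat, functional_extensionality; intros z.
  apply propositional_extensionality; split; intros H'.
  + exact (eqE_trans (eqE_sym H) H').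
  + exact (eqE_trans H H').
Qed.

Lemma cls_repr X : cls (repr X) = X.
Proof.
destruct X as [P HP]; apply subset_eq_compat; unfold repr; simpl.
now destruct (constructive_indefinite_description _ HP).
Qed.

Lemma repr_cls x : eqE (repr (cls x)) x.
Proof. apply cls_eq, cls_repr. Qed.

Lemma mem_cls X y : X ∈ cls y <-> exists i : idx y, X = cls (elt i).
Proof.
pose proof (eqE_sym (repr_cls y)) as E; unfold mem, inE.
destruct y as [B g], (repr (cls (sup g))) as [A f]; destruct E as [H1 H2]; simpl.
split; intros [i Hi].
- destruct (H2 i) as [b Hb]; exists b; rewrite <- (cls_repr X); apply cls_eq.
  exact (eqE_trans Hi (eqE_sym Hb)).
- destruct (H1 i) as [a Ha]; exists a; apply eqE_trans with (g i); trivial.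
  subst X; apply repr_cls.
Qed.

Lemma mem_elt y (i : idx y) : cls (elt i) ∈ cls y.
Proof. apply mem_cls; now exists i. Qed.

Lemma mem_idx X Y : X ∈ Y <-> exists i : idx (repr Y), X = cls (elt i).
Proof. rewrite <- (cls_repr Y) at 1; apply mem_cls. Qed.

Lemma V_ext X Y : (forall z, z ∈ X <-> z ∈ Y) -> X = Y.
Proof.
intros H; rewrite <- (cls_repr X), <- (cls_repr Y); apply cls_eq.
assert (H1 : forall z, z ∈ cls (repr X) <-> z ∈ cls (repr Y))
  by (now rewrite !cls_repr).
destruct (repr X) as [A f], (repr Y) as [B g]; split.
- intros a; pose proof (proj1 (H1 _) (mem_elt (y := sup f) a)) as H2.
  apply mem_cls in H2; destruct H2 as [b Hb]; exists b; now apply cls_eq.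
- intros b; pose proof (proj2 (H1 _) (mem_elt (y := sup g) b)) as H2.
  apply mem_cls in H2; destruct H2 as [a Ha]; exists a; now apply eqE_sym, cls_eq.
Qed.

Lemma V_foundation : well_founded mem.
Proof.
intros X; rewrite <- (cls_repr X); induction (repr X) as [A f IH].
constructor; intros Y HY; apply mem_cls in HY; destruct HY as [a ->]; apply IH.
Qed.

Lemma V_small (A : Type) (F : A -> Ens) : is_set (fun z => exists a, z = cls (F a)).
Proof. exists (cls (sup F)); intros z; apply mem_cls. Qed.

Lemma V_separation (P : V -> Prop) X : is_set (fun z => z ∈ X /\ P z).
Proof.
destruct (@V_small {i : idx (repr X) | P (cls (elt i))}
            (fun i => elt (proj1_sig i))) as [Y HY].
exists Y; intros z; rewrite HY, mem_idx; split.
- intros [[i Hi] ->]; split; eauto.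
- intros [[i ->] Hi]; exists (exist _ i Hi); trivial.
Qed.

Lemma V_replacement (F : V -> V) X : is_set (fun z => exists x, x ∈ X /\ z = F x).
Proof.
destruct (@V_small (idx (repr X)) (fun i => repr (F (cls (elt i))))) as [Y HY].
exists Y; intros z; rewrite HY; split.
- intros [i ->]; exists (cls (elt i)); rewrite cls_repr, mem_idx; eauto.
- intros [x [Hx ->]]; apply mem_idx in Hx; destruct Hx as [i ->].
  exists i; now rewrite cls_repr.
Qed.

Lemma V_pairing X Y : is_set (fun z => z = X \/ z = Y).
Proof.
destruct (@V_small bool (fun b => if b then repr X else repr Y)) as [Z HZ].
exists Z; intros z; rewrite HZ; split.
- intros [[|] ->]; rewrite cls_repr; auto.
- intros [-> | ->]; [exists true | exists false]; now rewrite cls_repr.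
Qed.

Definition bigcupE (A : Type) (F : A -> Ens) : Ens :=
  sup (fun p : {a : A & idx (F a)} => elt (projT2 p)).

Lemma mem_bigcupE A (F : A -> Ens) z :
  z ∈ cls (bigcupE F) <-> exists a, z ∈ cls (F a).
Proof.
rewrite mem_cls; split.
- intros [[a i] ->]; exists a; apply mem_cls; now exists i.
- intros [a Hz]; apply mem_cls in Hz; destruct Hz as [i ->].
  now exists (existT _ a i).
Qed.

Lemma V_union X : is_set (fun z => exists y, y ∈ X /\ z ∈ y).
Proof.
exists (cls (bigcupE (@elt (repr X)))); intros z; rewrite mem_bigcupE; split.
- intros [i Hi]; exists (cls (elt i)); rewrite mem_idx; eauto.
- intros [y [Hy Hz]]; apply mem_idx in Hy; destruct Hy as [i ->]; eauto.
Qed.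

Lemma V_powerset X : is_set (fun z => z ⊆ X).
Proof.
destruct (@V_small (idx (repr X) -> Prop)
  (fun P => sup (fun i : {i | P i} => elt (proj1_sig i)))) as [Y HY].
exists Y; intros z; rewrite HY; split.
- intros [P ->] w Hw; apply mem_cls in Hw; destruct Hw as [[i Hi] ->].
  apply mem_idx; now exists i.
- intros H; exists (fun i => cls (elt i) ∈ z); apply V_ext; intros w.
  rewrite mem_cls; split.
  + intros Hw; destruct (proj1 (mem_idx _ _) (H w Hw)) as [i ->].
    now exists (exist _ i Hw).
  + now intros [[i Hi] ->].
Qed.

Definition transitive (X : V) : Prop := forall y, y ∈ X -> y ⊆ X.

(* Well-foundedness of [∈] on [α] is [V_foundation]. *)
Definition ordinal (α : V) : Prop :=
  transitive α /\
  (forall x y, x ∈ α -> y ∈ α -> x ∈ y \/ x = y \/ y ∈ x).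

Definition succE (x : Ens) : Ens :=
  sup (fun o : option (idx x) => match o with Some i => elt i | None => x end).

Lemma mem_succE x z : z ∈ cls (succE x) <-> z ∈ cls x \/ z = cls x.
Proof.
rewrite !mem_cls; split.
- intros [[i|] ->]; [left; now exists i | now right].
- intros [[i ->] | ->]; [now exists (Some i) | now exists None].
Qed.

Fixpoint natE (n : nat) : Ens :=
  match n with O => sup (Empty_set_rect (fun _ => Ens)) | S n => succE (natE n) end.

Definition ord_nat (n : nat) : V := cls (natE n).
Definition omega : V := cls (sup natE).

Fixpoint rankE (x : Ens) : Ens :=
  match x with @sup A f => bigcupE (fun a : A => succE (rankE (f a))) end.

Definition rank (X : V) : V := cls (rankE (repr X)).

Lemma rankE_eq x z : z ∈ cls (rankE x) <->
  exists i : idx x, z ∈ cls (rankE (elt i)) \/ z = cls (rankE (elt i)).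
Proof.
destruct x as [A f]; simpl; rewrite mem_bigcupE.
split; intros [a H]; exists a; now apply mem_succE.
Qed.

Lemma rank_cls x : rank (cls x) = cls (rankE x).
Proof.
enough (E : forall x y, eqE x y -> cls (rankE x) = cls (rankE y))
  by apply E, repr_cls.
clear x; induction x as [A f IH]; intros [B g] [H1 H2].
apply V_ext; intros z; rewrite !rankE_eq; simpl; split.
- intros [a Ha]; destruct (H1 a) as [b Hb]; exists b.
  now rewrite <- (IH _ _ Hb).
- intros [b Hb]; destruct (H2 b) as [a Ha]; exists a.
  now rewrite (IH _ _ Ha).
Qed.

Lemma rank_eq X z : z ∈ rank X <-> exists y, y ∈ X /\ (z ∈ rank y \/ z = rank y).
Proof.
unfold rank at 1; rewrite rankE_eq; split.
- intros [i H]; exists (cls (elt i)); rewrite rank_cls, mem_idx; eauto.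
- intros [y [Hy H]]; apply mem_idx in Hy; destruct Hy as [i ->].
  rewrite rank_cls in H; eauto.
Qed.

Definition R (κ x : V) : Prop := rank x ∈ κ.

Lemma R_is_set κ : is_set (R κ).
Proof.
induction (V_foundation κ) as [κ _ IH].
pose (F ρ := epsilon (inhabits κ) (fun P =>
  ρ ∈ κ -> forall x, x ∈ P <-> forall y, y ∈ x -> R ρ y)).
assert (HF : forall ρ, ρ ∈ κ ->
          forall x, x ∈ F ρ <-> forall y, y ∈ x -> R ρ y).
{ intros ρ; unfold F; apply epsilon_spec; destruct (classic (ρ ∈ κ)) as [Hρ|N].
  - destruct (IH _ Hρ) as [X HX]; destruct (V_powerset X) as [P HP]; exists P.
    intros _ x; rewrite HP; split; intros H y Hy; apply HX; auto.
  - exists κ; tauto. }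
destruct (V_replacement F κ) as [Y HY]; destruct (V_union Y) as [U HU].
destruct (V_separation (R κ) U) as [Z HZ]; exists Z; intros x; rewrite HZ.
split; [tauto|]; intros Hx; split; trivial; apply HU; exists (F (rank x)).
split; [apply HY; eauto|]; apply HF; trivial; intros y Hy; apply rank_eq; eauto.
Qed.

Definition El (X : V) : V -> Prop := fun z => z ∈ X.

Definition equipotent (A B : V -> Prop) : Prop :=
  exists f : V -> V,
    (forall x, A x -> B (f x)) /\
    (forall x y, A x -> A y -> f x = f y -> x = y) /\
    (forall z, B z -> exists x, A x /\ f x = z).

Definition cardinal (κ : V) : Prop :=
  ordinal κ /\ forall α, α ∈ κ -> ~ equipotent (El α) (El κ).

Definition infinite_cardinal (κ : V) : Prop := cardinal κ /\ omega ⊆ κ.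
Definition uncountable_cardinal (κ : V) : Prop := cardinal κ /\ omega ∈ κ.

Definition regular (κ : V) : Prop :=
  forall (α : V) (f : V -> V), α ∈ κ -> (forall ξ, ξ ∈ α -> f ξ ∈ κ) ->
    exists β, β ∈ κ /\ forall ξ, ξ ∈ α -> f ξ ∈ β.

Definition strong_limit (κ : V) : Prop :=
  forall lam, lam ∈ κ -> cardinal lam ->
    exists μ, μ ∈ κ /\ cardinal μ /\ equipotent (fun x => x ⊆ lam) (El μ).

Definition inaccessible (κ : V) : Prop :=
  uncountable_cardinal κ /\ regular κ /\ strong_limit κ.

(* Membership of [x] in [[X]^n]. *)
Definition subsets_of_size (X : V) (n : nat) (x : V) : Prop :=
  x ⊆ X /\ equipotent (El x) (El (ord_nat n)).

(** The partition property [κ → (κ)^{<ω}_2]; only the values of the colouring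
    [f] on the finite subsets of [κ] matter. *)
Definition ramsey (κ : V) : Prop :=
  infinite_cardinal κ /\
  forall f : V -> bool, exists H : V,
    H ⊆ κ /\ equipotent (El H) (El κ) /\
    forall (n : nat) (x y : V),
      subsets_of_size H n x -> subsets_of_size H n y -> f x = f y.

(** Structures [(M, E, S)] with [E] binary and [S] unary.  Only the restrictions
    of [rel] and [prd] to [dom] matter. *)

Record structure : Type := Structure {
  dom : V -> Prop;
  rel : V -> V -> Prop;
  prd : V -> Prop
}.

(* Variables are de Bruijn indices. *)
Inductive formula : Type :=
| fEq (i j : nat)
| fRel (i j : nat)
| fPrd (i : nat)
| fNot (φ : formula)
| fAnd (φ ψ : formula)
| fEx (φ : formula).

Definition scons (a : V) (v : nat -> V) (n : nat) : V :=
  match n with O => a | S m => v m end.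

Fixpoint sat (A : structure) (φ : formula) (v : nat -> V) : Prop :=
  match φ with
  | fEq i j => v i = v j
  | fRel i j => rel A (v i) (v j)
  | fPrd i => prd A (v i)
  | fNot φ => ~ sat A φ v
  | fAnd φ ψ => sat A φ v /\ sat A ψ v
  | fEx φ => exists a, dom A a /\ sat A φ (scons a v)
  end.

Definition elementary_extension (A B : structure) : Prop :=
  (forall a, dom A a -> dom B a) /\
  forall (φ : formula) (v : nat -> V), (forall n, dom A (v n)) ->
    (sat A φ v <-> sat B φ v).

Definition eee (A B : structure) : Prop :=
  elementary_extension A B /\
  (exists b, dom B b /\ ~ dom A b) /\
  forall a, dom A a ->
    forall b, (dom A b /\ rel A b a) <-> (dom B b /\ rel B b a).

Definition wf_structure (A : structure) : Prop :=
  well_founded (fun b a => dom A b /\ dom A a /\ rel A b a).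

Definition collapse (A : structure) (π : V -> V) : Prop :=
  forall a, dom A a ->
    forall z, z ∈ π a <-> exists b, dom A b /\ rel A b a /\ z = π b.

(** The ordinal height of a well-founded structure is the set of ordinals
    belonging to its transitive (Mostowski) collapse. *)
Definition height (A : structure) (θ : V) : Prop :=
  exists π, collapse A π /\
    forall z, z ∈ θ <-> ordinal z /\ exists a, dom A a /\ π a = z.

Definition unfoldable (κ : V) : Prop :=
  inaccessible κ /\
  forall α S : V, ordinal α -> (forall x, x ∈ S -> R κ x) ->
    exists M : structure,
      is_set (dom M) /\ wf_structure M /\
      eee (Structure (R κ) mem (El S)) M /\
      exists θ, height M θ /\ α ⊆ θ.

(* Main.v *)
Require Import Defs.
From Stdlib Require Import Classical ClassicalEpsilon FunctionalExtensionality
  PropExtensionality List Sorted Arith Lia.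
Import ListNotations.

Set Implicit Arguments.
Unset Strict Implicit.

(** Inaccessibility: homogeneous sets of size [κ] for suitable colourings show in
    turn that [κ] is a limit and is not [ω], that a map from [κ] to a smaller set
    is constant on a set of size [κ] (whence regularity), and that [κ] does
    not inject into the power set of a smaller set ([small_power], whence
    strong limit).

    Unfoldability: the structure on [R κ] is given Skolem functions, and a
    homogeneous set yields a set [H] of [κ] many indiscernibles which are good:
    increasing tuples of [H] above [γ] in [H] have the same type even with
    parameters of rank below [γ] ([indiscernibles]).  Given an ordinal [lam],
    consider the Skolem terms in constants for the elements of [R κ] and one
    symbol for each element of [lam].  A statement about such terms is declared
    true when it holds after sending the symbols which occur in it increasingly
    into [H], above the ranks of the constants which occur; by
    indiscernibility the choice does not matter ([good_agree]).

    The membership relation obtained on terms is well founded: a descending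
    sequence of terms involves countably many symbols, and as [κ] is regular and
    uncountable one assignment interprets all of them in [R κ]
    ([good_exists], [memt_wf]).  Its transitive collapse is the model.  Truth in
    it is truth of the values in [R κ] ([los]).  A term which is an element of a
    constant [c] takes an element of [c] as its value, and this value is itself
    a constant, so that the collapse fixes [R κ] pointwise and extends it at the
    end ([coll_const]).  Finally the symbols for the elements of [lam]
    are collapsed to an increasing sequence of ordinals, which makes the height of
    the model at least [lam]. *)

(** * Ordinals *)

Lemma mem_irrefl x : ~ x ∈ x.
Proof. induction (V_foundation x) as [x _ IH]; intros H; exact (IH x H H). Qed.

Lemma mem_asym x y : x ∈ y -> ~ y ∈ x.
Proof.
revert y; induction (V_foundation x) as [x _ IH]; intros y Hxy Hyx.
exact (IH y Hyx x Hyx Hxy).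
Qed.

Lemma mem_no_3cycle x y z : x ∈ y -> y ∈ z -> ~ z ∈ x.
Proof.
revert y z; induction (V_foundation x) as [x _ IH]; intros y z Hxy Hyz Hzx.
exact (IH z Hzx x y Hzx Hxy Hyz).
Qed.

Lemma mem_minimal (P : V -> Prop) :
  (exists x, P x) -> exists x, P x /\ forall y, P y -> ~ y ∈ x.
Proof.
intros [x Hx]; revert Hx; induction (V_foundation x) as [x _ IH]; intros Hx.
destruct (classic (exists y, P y /\ y ∈ x)) as [[y [Hy Hyx]]|N]; eauto.
exists x; split; trivial; intros y Hy Hyx; apply N; eauto.
Qed.

Lemma ordinal_mem a b : ordinal a -> b ∈ a -> ordinal b.
Proof.
intros [Ta Ca] Hb; split.
- intros y Hy z Hz; pose proof (Ta _ Hb _ Hy) as Hya.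
  destruct (Ca z b (Ta _ Hya _ Hz) Hb) as [H|[H|H]]; trivial.
  + subst z; destruct (mem_asym Hy Hz).
  + destruct (mem_no_3cycle H Hz Hy).
- intros x y Hx Hy; apply Ca; eapply Ta; eauto.
Qed.

Lemma ordinal_trans a x y : ordinal a -> y ∈ a -> x ∈ y -> x ∈ a.
Proof. intros [Ta _] Hy Hx; exact (Ta y Hy x Hx). Qed.

Lemma ordinal_trichotomy a b :
  ordinal a -> ordinal b -> a ∈ b \/ a = b \/ b ∈ a.
Proof.
revert b; induction (V_foundation a) as [a _ IHa]; intros b Ha.
induction (V_foundation b) as [b _ IHb]; intros Hb.
destruct (classic (a ∈ b)) as [|Nab]; auto.
destruct (classic (b ∈ a)) as [|Nba]; auto.
right; left; apply V_ext; intros z; split; intros Hz.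
- destruct (IHa z Hz b (ordinal_mem Ha Hz) Hb) as [H|[H|H]]; trivial.
  + subst z; tauto.
  + destruct Nba; exact (ordinal_trans Ha Hz H).
- destruct (IHb z Hz (ordinal_mem Hb Hz)) as [H|[H|H]]; trivial.
  + destruct Nab; exact (ordinal_trans Hb Hz H).
  + subst z; tauto.
Qed.

Lemma ordinal_sub a b : ordinal a -> ordinal b -> a ⊆ b -> a ∈ b \/ a = b.
Proof.
intros Ha Hb H; destruct (ordinal_trichotomy Ha Hb) as [|[|K]]; auto.
destruct (mem_irrefl (H _ K)).
Qed.

Lemma rank_mem x y : x ∈ y -> rank x ∈ rank y.
Proof. intros H; apply rank_eq; eauto. Qed.

Lemma rank_ordinal a : ordinal a -> rank a = a.
Proof.
induction (V_foundation a) as [a _ IH]; intros Ha; apply V_ext; intros z.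
rewrite rank_eq; split.
- intros [y [Hy H]]; rewrite (IH y Hy (ordinal_mem Ha Hy)) in H.
  destruct H as [H | ->]; trivial; exact (ordinal_trans Ha Hy H).
- intros Hz; exists z; split; trivial; right.
  now rewrite (IH z Hz (ordinal_mem Ha Hz)).
Qed.

Lemma mem_ord_nat n z : z ∈ ord_nat n <-> exists m, m < n /\ z = ord_nat m.
Proof.
revert z; induction n as [|n IH]; intros z; unfold ord_nat at 1; simpl natE.
- rewrite mem_cls; split; [intros [[] _] | intros [m [H _]]; lia].
- rewrite mem_succE; change (cls (natE n)) with (ord_nat n); rewrite IH; split.
  + intros [[m [H ->]] | ->]; [exists m | exists n]; split; trivial; lia.
  + intros [m [H ->]]; destruct (Nat.eq_dec m n) as [->|]; auto.
    left; exists m; split; trivial; lia.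
Qed.

Lemma ord_nat_inj m n : ord_nat m = ord_nat n -> m = n.
Proof.
enough (K : forall m n, m < n -> ord_nat m <> ord_nat n).
{ intros E; destruct (Nat.lt_trichotomy m n) as [H|[H|H]]; trivial.
  - destruct (K _ _ H E).
  - destruct (K _ _ H (eq_sym E)). }
clear m n; intros m n H E; apply (@mem_irrefl (ord_nat n)).
rewrite <- E at 1; apply mem_ord_nat; eauto.
Qed.

Lemma mem_omega z : z ∈ omega <-> exists n, z = ord_nat n.
Proof. apply (mem_cls z (sup natE)). Qed.

Lemma omega_ordinal : ordinal omega.
Proof.
split.
- intros y Hy z Hz; apply mem_omega in Hy; destruct Hy as [n ->].
  apply mem_ord_nat in Hz; destruct Hz as [m [_ ->]]; apply mem_omega; eauto.
- intros x y Hx Hy; apply mem_omega in Hx, Hy.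
  destruct Hx as [m ->], Hy as [n ->].
  destruct (Nat.lt_trichotomy m n) as [H|[->|H]]; auto;
  [left | right; right]; apply mem_ord_nat; eauto.
Qed.

(** * Strictly increasing lists of ordinals *)

Notation sorted := (StronglySorted mem).

Lemma sorted_NoDup l : sorted l -> NoDup l.
Proof.
induction 1 as [|a l _ IH Ha]; constructor; trivial.
rewrite Forall_forall in Ha; intros H; exact (mem_irrefl (Ha a H)).
Qed.

Lemma sorted_unique l l' :
  sorted l -> sorted l' -> (forall z, In z l <-> In z l') -> l = l'.
Proof.
intros Hl; revert l'; induction Hl as [|a l Hl IH Ha]; intros l' Hl' E.
- destruct l' as [|b l']; trivial; destruct (proj2 (E b)); now left.
- destruct Hl' as [|b l' Hl' Hb]; [destruct (proj1 (E a)); now left|].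
  rewrite Forall_forall in Ha, Hb.
  assert (a = b) as <-.
  { destruct (proj1 (E a)) as [|H]; [now left | auto |].
    destruct (proj2 (E b)) as [|H']; [now left | auto |].
    destruct (mem_asym (Ha _ H') (Hb _ H)). }
  f_equal; apply IH; trivial; intros z; split; intros H.
  + destruct (proj1 (E z)) as [<-|]; [now right | | trivial].
    destruct (mem_irrefl (Ha _ H)).
  + destruct (proj2 (E z)) as [<-|]; [now right | | trivial].
    destruct (mem_irrefl (Hb _ H)).
Qed.

Lemma sorted_app l l' :
  sorted l -> sorted l' -> (forall x y, In x l -> In y l' -> x ∈ y) ->
  sorted (l ++ l').
Proof.
intros Hl Hl' H; induction Hl as [|a l Hl IH Ha]; simpl; trivial.
constructor; [apply IH; intros; apply H; simpl; auto|].
apply Forall_app; split; trivial; apply Forall_forall; intros y Hy.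
apply H; simpl; auto.
Qed.

Lemma sorted_map (f : V -> V) l : sorted l ->
  (forall x y, In x l -> In y l -> x ∈ y -> f x ∈ f y) -> sorted (map f l).
Proof.
induction 1 as [|a l Hl IH Ha]; simpl; intros Hf; constructor.
- apply IH; auto.
- rewrite Forall_forall in *; intros y Hy; apply in_map_iff in Hy.
  destruct Hy as [x [<- Hx]]; auto.
Qed.

Lemma sorted_enum (l : list V) : (forall x, In x l -> ordinal x) ->
  exists l', sorted l' /\ forall x, In x l' <-> In x l.
Proof.
enough (K : forall a l, ordinal a -> (forall x, In x l -> ordinal x) -> sorted l ->
  exists l', sorted l' /\ forall x, In x l' <-> x = a \/ In x l).
{ induction l as [|a l IH]; intros Ho; [exists []; split; [constructor|tauto]|].
  destruct IH as [l' [Hl' E]]; [intros; apply Ho; simpl; auto|].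
  destruct (K a l') as [m [Hm Em]]; trivial.
  - apply Ho; now left.
  - intros x Hx; apply Ho; right; now apply E.
  - exists m; split; trivial; intros x; rewrite Em, E; simpl; intuition. }
clear l; intros a l Ha Ho Hl; induction Hl as [|b l Hl IH Hb].
{ exists [a]; split; [repeat constructor|simpl; intuition]. }
destruct (@ordinal_trichotomy a b) as [H|[<-|H]]; trivial.
- apply Ho; now left.
- exists (a :: b :: l); split; [|simpl; intuition].
  constructor; [now constructor|]; constructor; trivial.
  rewrite Forall_forall in *; intros x Hx.
  apply (@ordinal_trans x a b); auto; apply Ho; now right.
- exists (a :: l); split; [now constructor|simpl; intuition].
- destruct IH as [m [Hm E]]; [intros; apply Ho; now right|].
  exists (b :: m); split.
  + constructor; trivial; rewrite Forall_forall in *; intros x Hx.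
    apply E in Hx; destruct Hx as [->|Hx]; auto.
  + intros x; simpl; rewrite E; intuition.
Qed.

Lemma app_eq_length T (a b a' b' : list T) :
  a ++ b = a' ++ b' -> length a = length a' -> a = a' /\ b = b'.
Proof.
revert a'; induction a as [|x a IH]; intros [|x' a']; simpl; try discriminate; auto.
intros E L; injection E as -> E; destruct (IH a') as [-> ->]; auto.
Qed.

Lemma list_is_set (l : list V) : is_set (fun z => In z l).
Proof.
destruct (@V_small {n | n < length l} (fun n => repr (nth (proj1_sig n) l omega)))
  as [X HX].
exists X; intros z; rewrite HX; split.
- intros [[n Hn] ->]; rewrite cls_repr; now apply nth_In.
- intros H; destruct (In_nth _ _ omega H) as [n [Hn E]].
  exists (exist _ n Hn); now rewrite cls_repr.
Qed.

Lemma list_equipotent l :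
  NoDup l -> equipotent (fun z => In z l) (El (ord_nat (length l))).
Proof.
induction 1 as [|a l Ha _ [f [F1 [F2 F3]]]].
- exists id; repeat split; simpl; try tauto.
  intros z Hz; apply mem_ord_nat in Hz; destruct Hz as [m [Hm _]]; inversion Hm.
- exists (fun z => if excluded_middle_informative (z = a)
                   then ord_nat (length l) else f z).
  assert (K : forall x, In x l -> f x <> ord_nat (length l)).
  { intros x Hx E; apply (@mem_irrefl (f x)); rewrite E at 2; now apply F1. }
  repeat split; unfold El; simpl length.
  + intros x Hx; destruct (excluded_middle_informative (x = a)) as [->|N].
    * apply mem_ord_nat; eauto.
    * destruct Hx as [Hx|Hx]; [congruence|]; apply F1, mem_ord_nat in Hx.
      destruct Hx as [m [Hm E]]; apply mem_ord_nat; exists m; auto.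
  + intros x y Hx Hy.
    destruct (excluded_middle_informative (x = a)) as [->|Nx],
      (excluded_middle_informative (y = a)) as [->|Ny]; trivial; intros E;
      destruct Hx as [Hx|Hx], Hy as [Hy|Hy]; try congruence.
    * symmetry in E; destruct (K _ Hy E).
    * destruct (K _ Hx E).
    * auto.
  + intros z Hz; apply mem_ord_nat in Hz; destruct Hz as [m [Hm ->]].
    destruct (Nat.eq_dec m (length l)) as [->|N].
    * exists a; split; [now left|].
      now destruct (excluded_middle_informative (a = a)).
    * destruct (F3 (ord_nat m)) as [x [Hx E]].
      { apply mem_ord_nat; exists m; split; trivial; lia. }
      exists x; split; [now right|].
      destruct (excluded_middle_informative (x = a)) as [->|]; tauto.
Qed.

(** * Cardinality *)

Definition inj_on (T : Type) (A : V -> Prop) (F : V -> T) : Prop :=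
  forall x y, A x -> A y -> F x = F y -> x = y.

Lemma equipotent_sym A B : equipotent A B -> equipotent B A.
Proof.
intros [f [F1 [F2 F3]]].
pose (g z := epsilon (inhabits z) (fun x => A x /\ f x = z)).
assert (G : forall z, B z -> A (g z) /\ f (g z) = z)
  by (intros z Hz; unfold g; apply epsilon_spec; auto).
exists g; repeat split.
- intros z Hz; now apply G.
- intros x y Hx Hy E; destruct (G x Hx) as [_ Ex], (G y Hy) as [_ Ey]; congruence.
- intros x Hx; exists (f x); split; auto; apply F2; trivial; apply G; auto.
Qed.

Lemma equipotent_trans A B C : equipotent A B -> equipotent B C -> equipotent A C.
Proof.
intros [f [F1 [F2 F3]]] [g [G1 [G2 G3]]]; exists (fun x => g (f x)); repeat split; auto.
intros z Hz; destruct (G3 z Hz) as [y [Hy <-]], (F3 y Hy) as [x [Hx <-]]; eauto.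
Qed.

(** The Cantor-Bernstein argument: an injection of [κ] into a smaller ordinal is
    corrected to a bijection by leaving fixed all points that are not obtained by
    iterating it on points outside that ordinal. *)
Lemma cardinal_no_injection κ α (f : V -> V) :
  cardinal κ -> α ∈ κ -> (forall x, x ∈ κ -> f x ∈ α) -> ~ inj_on (El κ) f.
Proof.
intros [Hκ C] Hα Hf If; apply (C α Hα), equipotent_sym.
pose (D x := exists n y, y ∈ κ /\ ~ y ∈ α /\ Nat.iter n f y = x).
assert (DS : forall x, D x -> D (f x)).
{ intros x [n [y [Hy [Ny E]]]]; exists (S n), y; simpl; now rewrite E. }
exists (fun x => if excluded_middle_informative (D x) then f x else x).
unfold El; repeat split.
- intros x Hx; destruct (excluded_middle_informative (D x)) as [Dx|Dx]; auto.
  apply NNPP; intros N; apply Dx; exists 0, x; auto.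
- intros x y Hx Hy.
  destruct (excluded_middle_informative (D x)) as [Dx|Dx],
    (excluded_middle_informative (D y)) as [Dy|Dy]; trivial; intros E.
  + now apply If.
  + subst y; destruct (Dy (DS _ Dx)).
  + subst x; destruct (Dx (DS _ Dy)).
- intros z Hz; destruct (classic (D z)) as [Dz|Dz].
  + destruct Dz as [[|n] [y [Hy [Ny E]]]]; [simpl in E; congruence|].
    assert (Hn : D (Nat.iter n f y)) by (exists n, y; auto).
    exists (Nat.iter n f y); split.
    * clear - Hy Hf Hκ Hα; destruct n as [|n]; trivial; simpl.
      induction n as [|n IH]; [|simpl];
        apply (ordinal_trans Hκ Hα), Hf; trivial.
    * destruct (excluded_middle_informative (D (Nat.iter n f y))); tauto.
  + exists z; split; [exact (ordinal_trans Hκ Hα Hz)|].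
    destruct (excluded_middle_informative (D z)); tauto.
Qed.

(** * Consequences of the partition property *)

(** Well-founded recursion in which each value is chosen; the first hypothesis makes
    the condition on the choice depend on earlier values only. *)
Lemma mem_recursion (T : Type) (t0 : T) (Q : V -> (V -> T) -> T -> Prop) :
  (forall ξ g g' t, (forall η, η ∈ ξ -> g η = g' η) -> Q ξ g t -> Q ξ g' t) ->
  (forall ξ g, exists t, Q ξ g t) ->
  exists g, forall ξ, Q ξ g (g ξ).
Proof.
intros Hext Hex.
pose (extend ξ (rec : forall η, η ∈ ξ -> T) η :=
  match excluded_middle_informative (η ∈ ξ) with
  | left H => rec η H
  | right _ => t0
  end).
pose (step ξ rec := epsilon (inhabits t0) (Q ξ (extend ξ rec))).
pose (g := Fix V_foundation (fun _ => T) step).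
assert (E : forall ξ, g ξ = step ξ (fun η _ => g η)).
{ intros ξ; unfold g; apply (Fix_eq V_foundation (fun _ => T) step).
  intros x f f' H; f_equal; extensionality y; extensionality p; apply H. }
exists g; intros ξ; apply Hext with (extend ξ (fun η _ => g η)).
- intros η Hη; unfold extend.
  now destruct (excluded_middle_informative (η ∈ ξ)).
- rewrite E; unfold step; apply epsilon_spec, Hex.
Qed.

Section Ramsey.

Variable κ : V.
Hypothesis κ_ramsey : ramsey κ.

Lemma κ_cardinal : cardinal κ.
Proof. apply κ_ramsey. Qed.

Lemma κ_ordinal : ordinal κ.
Proof. apply κ_cardinal. Qed.

Lemma mem_κ_ordinal x : x ∈ κ -> ordinal x.
Proof. apply ordinal_mem, κ_ordinal. Qed.

Lemma κ_trans x y : y ∈ κ -> x ∈ y -> x ∈ κ.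
Proof. apply ordinal_trans, κ_ordinal. Qed.

Lemma ord_nat_κ n : ord_nat n ∈ κ.
Proof. apply (proj2 (proj1 κ_ramsey)), mem_omega; eauto. Qed.

Definition large (A : V -> Prop) : Prop :=
  exists j : V -> V, (forall x, x ∈ κ -> A (j x)) /\ inj_on (El κ) j.

Lemma large_no_injection A α (f : V -> V) :
  large A -> α ∈ κ -> (forall x, A x -> f x ∈ α) -> ~ inj_on A f.
Proof.
intros [j [Hj Ij]] Hα Hf If.
apply (@cardinal_no_injection κ α (fun x => f (j x))); auto using κ_cardinal.
intros x y Hx Hy E; auto.
Qed.

(** Finite subsets of [κ] correspond to their increasing enumerations, so that
    the partition property may be used for properties of increasing lists. *)
Lemma homogeneous (P : list V -> Prop) :
  exists H, H ⊆ κ /\ large (El H) /\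
    forall l l', sorted l -> sorted l' -> length l = length l' ->
      (forall x, In x l -> x ∈ H) -> (forall x, In x l' -> x ∈ H) -> P l -> P l'.
Proof.
pose (Q X := exists l, sorted l /\ (forall z, z ∈ X <-> In z l) /\ P l).
destruct (proj2 κ_ramsey (fun X => if excluded_middle_informative (Q X)
  then true else false)) as [H [HH [LH Hom]]].
exists H; split; [|split]; trivial.
- destruct (equipotent_sym LH) as [j [J1 [J2 _]]]; now exists j.
- intros l l' Sl Sl' E Hl Hl' Pl.
  destruct (list_is_set l) as [X HX], (list_is_set l') as [Y HY].
  assert (K : forall m Z, sorted m -> (forall x, In x m -> x ∈ H) ->
    (forall z, z ∈ Z <-> In z m) -> subsets_of_size H (length m) Z).
  { intros m Z Sm Hm HZ; split; [intros z Hz; apply Hm, HZ, Hz|].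
    assert (El Z = fun z => In z m) as ->.
    { extensionality z; apply propositional_extensionality, HZ. }
    now apply list_equipotent, sorted_NoDup. }
  specialize (Hom (length l) X Y (K _ _ Sl Hl HX)).
  rewrite E in Hom; specialize (Hom (K _ _ Sl' Hl' HY)).
  destruct (excluded_middle_informative (Q X)) as [_|N];
    [|destruct N; exists l; auto].
  destruct (excluded_middle_informative (Q Y)) as [[m [Sm [HY' Pm]]]|];
    [|discriminate].
  replace l' with m; trivial; apply sorted_unique; trivial.
  intros z; now rewrite <- HY, HY'.
Qed.

(** ** Unboundedness *)

Lemma large_not_sub A β : large A -> β ∈ κ -> exists x, A x /\ ~ x ∈ β.
Proof.
intros LA Hβ; apply NNPP; intros N.
apply (@large_no_injection A β id LA Hβ); [|now intros x y].
intros x Hx; apply NNPP; intros Nx; apply N; eauto.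
Qed.

(** A largest element [β] of [κ] could be singled out by a colouring of the
    one-element sets. *)
Lemma κ_limit β : β ∈ κ -> exists γ, γ ∈ κ /\ β ∈ γ.
Proof.
intros Hβ; apply NNPP; intros N.
destruct (homogeneous (fun l => l = [β])) as [H [HH [LH Hom]]].
destruct (large_not_sub LH Hβ) as [x [Hx Nx]].
assert (x = β) as ->.
{ destruct (@ordinal_trichotomy x β) as [K|[K|K]]; auto using mem_κ_ordinal;
    [tauto|destruct N; eauto]. }
assert (E : forall y, y ∈ H -> y = β).
{ intros y Hy; enough ([y] = [β]) by congruence; apply Hom with [β]; trivial.
  - repeat constructor.
  - repeat constructor.
  - intros z [<-|[]]; trivial.
  - intros z [<-|[]]; trivial. }
apply (@large_no_injection (El H) (ord_nat 1) (fun _ => ord_nat 0) LH).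
- apply ord_nat_κ.
- intros _ _; apply mem_ord_nat; eauto.
- intros y z Hy Hz _; rewrite (E y Hy); symmetry; auto.
Qed.

Lemma large_unbounded A β : (forall x, A x -> x ∈ κ) -> large A -> β ∈ κ ->
  exists x, A x /\ β ∈ x.
Proof.
intros AK LA Hβ; destruct (κ_limit Hβ) as [γ [Hγ Hβγ]].
destruct (large_not_sub LA Hγ) as [x [Hx Nx]]; exists x; split; trivial.
destruct (@ordinal_trichotomy x γ) as [H|[->|H]]; auto using mem_κ_ordinal; [tauto|].
apply (@ordinal_trans x β γ); auto using mem_κ_ordinal.
Qed.

Lemma max_κ β γ : β ∈ κ -> γ ∈ κ ->
  exists δ, δ ∈ κ /\ (forall x, x ∈ β -> x ∈ δ) /\ (forall x, x ∈ γ -> x ∈ δ).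
Proof.
intros Hβ Hγ.
destruct (@ordinal_trichotomy β γ) as [H|[->|H]]; auto using mem_κ_ordinal.
- exists γ; repeat split; auto.
  intros x Hx; apply (@ordinal_trans γ x β); auto using mem_κ_ordinal.
- exists γ; auto.
- exists β; repeat split; auto.
  intros x Hx; apply (@ordinal_trans β x γ); auto using mem_κ_ordinal.
Qed.

Lemma list_bounded l : (forall x, In x l -> x ∈ κ) ->
  exists β, β ∈ κ /\ forall x, In x l -> x ∈ β.
Proof.
induction l as [|a l IH]; intros Hl.
- exists (ord_nat 0); split; [apply ord_nat_κ|intros x []].
- destruct IH as [β [Hβ B]]; [intros; apply Hl; now right|].
  destruct (@κ_limit a) as [γ [Hγ G]]; [apply Hl; now left|].
  destruct (max_κ Hβ Hγ) as [δ [Hδ [D1 D2]]].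
  exists δ; split; trivial; intros x [<-|Hx]; auto.
Qed.

Lemma large_blocks A β n : (forall x, A x -> x ∈ κ) -> large A -> β ∈ κ ->
  exists l, length l = n /\ sorted l /\ forall x, In x l -> A x /\ β ∈ x.
Proof.
intros AK LA; revert β; induction n as [|n IH]; intros β Hβ.
- exists []; split; [|split]; [trivial|constructor|intros x []].
- destruct (large_unbounded AK LA Hβ) as [a [Ha Hβa]].
  destruct (IH a) as [l [El [Sl Hl]]]; [auto|].
  exists (a :: l); split; [simpl; auto|split].
  + constructor; trivial; apply Forall_forall; intros x Hx; now apply Hl.
  + intros x [<-|Hx]; auto; destruct (Hl x Hx); split; trivial.
    apply (@ordinal_trans x β a); auto using mem_κ_ordinal.
Qed.

(** The colouring which asks whether the size of a finite set is below its
    least element has no infinite homogeneous set of natural numbers. *)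
Lemma omega_κ : omega ∈ κ.
Proof.
destruct (ordinal_sub omega_ordinal κ_ordinal (proj2 (proj1 κ_ramsey)))
  as [|E]; trivial; exfalso.
destruct (homogeneous (fun l => exists a t, l = a :: t /\ ord_nat (length l) ∈ a))
  as [H [HH [LH Hom]]].
destruct (large_not_sub LH (ord_nat_κ 0)) as [a [Ha _]].
pose proof (HH a Ha) as Ka; rewrite <- E in Ka; apply mem_omega in Ka.
destruct Ka as [m ->].
destruct (large_blocks m HH LH (HH _ Ha)) as [l [Ll [Sl Hl]]].
destruct (large_blocks (S m) HH LH (ord_nat_κ (S m))) as [l' [Ll' [Sl' Hl']]].
destruct (Hom l' (ord_nat m :: l)) as [b [t [Eb Hb]]]; trivial.
- constructor; trivial; apply Forall_forall; intros x Hx; now apply Hl.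
- simpl; congruence.
- intros x Hx; now apply Hl'.
- intros x [<-|Hx]; trivial; now apply Hl.
- destruct l' as [|b t]; [discriminate|]; exists b, t; split; trivial.
  rewrite Ll'; apply Hl'; now left.
- injection Eb as <- <-; apply mem_ord_nat in Hb; destruct Hb as [k [Hk Ek]].
  apply ord_nat_inj in Ek; simpl in Ek; lia.
Qed.

(** ** Small classes *)

(** Stated negatively, as the absence of an injection of [κ], smallness has
    closure properties which need no cardinal arithmetic: they follow from
    [small_constant]. *)
Definition small (T : Type) (P : T -> Prop) : Prop :=
  forall F : V -> T, (forall x, x ∈ κ -> P (F x)) -> ~ inj_on (El κ) F.

Lemma small_no_injection T (P : T -> Prop) A (F : V -> T) :
  small P -> large A -> (forall x, A x -> P (F x)) -> ~ inj_on A F.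
Proof.
intros SP [j [J1 J2]] HF IF; apply (SP (fun x => F (j x))); auto.
intros x y Hx Hy E; auto.
Qed.

Lemma small_mono T (P Q : T -> Prop) :
  (forall t, P t -> Q t) -> small Q -> small P.
Proof. intros H SQ F HF; apply SQ; auto. Qed.

Lemma small_inj T U (P : T -> Prop) (Q : U -> Prop) (f : T -> U) :
  (forall t, P t -> Q (f t)) ->
  (forall t t', P t -> P t' -> f t = f t' -> t = t') -> small Q -> small P.
Proof.
intros Hf If SQ F HF IF; apply (SQ (fun x => f (F x))); auto.
intros x y Hx Hy E; auto.
Qed.

Lemma small_ordinal α : α ∈ κ -> small (El α).
Proof.
intros Hα F HF; apply (@cardinal_no_injection κ α); auto using κ_cardinal.
Qed.

Lemma small_nat (P : nat -> Prop) : small P.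
Proof.
apply small_inj with (Q := El omega) (f := ord_nat).
- intros t _; apply mem_omega; eauto.
- intros t t' _ _; apply ord_nat_inj.
- apply small_ordinal, omega_κ.
Qed.

(** On a set homogeneous for the colouring of pairs by equality of the values, the
    map is constant or injective. *)
Lemma small_constant T (P : T -> Prop) (F : V -> T) :
  small P -> (forall x, x ∈ κ -> P (F x)) ->
  exists H, H ⊆ κ /\ large (El H) /\ forall x y, x ∈ H -> y ∈ H -> F x = F y.
Proof.
intros SP HF.
destruct (homogeneous (fun l => exists x y, l = [x; y] /\ F x = F y))
  as [H [HH [LH Hom]]].
exists H; split; [|split]; trivial.
assert (S2 : forall x y, x ∈ y -> sorted [x; y]) by (intros; repeat constructor; auto).
assert (H2 : forall x y, x ∈ H -> y ∈ H -> forall z, In z [x; y] -> z ∈ H)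
  by (intros x y Hx Hy z [<-|[<-|[]]]; trivial).
destruct (classic (exists x y, x ∈ H /\ y ∈ H /\ x ∈ y /\ F x = F y))
  as [[a [b [Ha [Hb [Hab E]]]]]|N].
- assert (K : forall x y, x ∈ H -> y ∈ H -> x ∈ y -> F x = F y).
  { intros x y Hx Hy Hxy.
    destruct (Hom [a; b] [x; y]) as [x' [y' [E1 E2]]]; eauto.
    injection E1 as -> ->; trivial. }
  intros x y Hx Hy.
  destruct (@ordinal_trichotomy x y) as [L|[->|L]]; auto using mem_κ_ordinal.
  symmetry; auto.
- exfalso; apply (@small_no_injection T P (El H) F); trivial; [intros; auto|].
  intros x y Hx Hy E.
  destruct (@ordinal_trichotomy x y) as [L|[|L]]; auto using mem_κ_ordinal;
    exfalso; apply N; eauto 6.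
Qed.

Lemma small_fibres T U (P : T -> Prop) (Q : U -> Prop) (f : T -> U) :
  small Q -> (forall t, P t -> Q (f t)) ->
  (forall u, Q u -> small (fun t => P t /\ f t = u)) -> small P.
Proof.
intros SQ Hf SF F HF IF.
destruct (small_constant SQ (F := fun x => f (F x))) as [H [HH [[j [J1 J2]] C]]]; auto.
pose proof (J1 _ (ord_nat_κ 0)) as H0.
apply (SF (f (F (j (ord_nat 0))))) with (fun x => F (j x)).
- apply Hf, HF, HH, H0.
- intros x Hx; split; [apply HF, HH, J1, Hx|].
  apply C; trivial; now apply J1.
- intros x y Hx Hy E; apply J2; trivial; apply IF; trivial; apply HH; now apply J1.
Qed.

Lemma small_prod T U (P : T -> Prop) (Q : U -> Prop) :
  small P -> small Q -> small (fun p => P (fst p) /\ Q (snd p)).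
Proof.
intros SP SQ; apply small_fibres with (Q := P) (f := fst); trivial; [tauto|].
intros u _; apply small_inj with (Q := Q) (f := snd); trivial; [tauto|].
intros [t1 u1] [t2 u2]; simpl; intros; intuition congruence.
Qed.

Lemma small_or T (P Q : T -> Prop) :
  small P -> small Q -> small (fun t => P t \/ Q t).
Proof.
intros SP SQ.
apply small_fibres with (Q := fun _ => True)
  (f := fun t => if excluded_middle_informative (P t) then 0 else 1); trivial.
- apply small_nat.
- intros [|n] _.
  + apply small_mono with P; trivial.
    intros t [_ E]; destruct (excluded_middle_informative (P t)); now trivial.
  + apply small_mono with Q; trivial.
    intros t [H E]; destruct (excluded_middle_informative (P t)); [easy|tauto].
Qed.

Lemma small_image T U (P : T -> Prop) (f : T -> U) :
  small P -> small (fun u => exists t, P t /\ f t = u).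
Proof.
intros SP F HF IF.
destruct (HF _ (ord_nat_κ 0)) as [t0 _].
pose (G x := epsilon (inhabits t0) (fun t => P t /\ f t = F x)).
assert (HG : forall x, x ∈ κ -> P (G x) /\ f (G x) = F x)
  by (intros x Hx; unfold G; apply epsilon_spec; auto).
apply (SP G); [intros x Hx; now apply HG|].
intros x y Hx Hy E; apply IF; trivial.
destruct (HG x Hx) as [_ <-], (HG y Hy) as [_ <-]; now rewrite E.
Qed.

(** A choice recursion enumerates [P] without repetition until it is exhausted;
    for a small class this happens before stage [κ]. *)
Lemma small_enumeration T (P : T -> Prop) t0 : P t0 -> small P ->
  exists ξ (g : V -> T), ξ ∈ κ /\ (forall η, P (g η)) /\
    inj_on (El ξ) g /\ forall t, P t -> exists η, η ∈ ξ /\ g η = t.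
Proof.
intros H0 SP.
pose (fresh ξ (g : V -> T) t := P t /\ forall η, η ∈ ξ -> g η <> t).
destruct (@mem_recursion T t0
  (fun ξ g t => P t /\ ((exists t', fresh ξ g t') -> fresh ξ g t))) as [g Hg].
- intros ξ g g' t E [Pt H]; split; trivial.
  intros [t' [P' N']]; destruct H as [_ N].
  + exists t'; split; trivial; intros η Hη; rewrite E; auto.
  + split; trivial; intros η Hη; rewrite <- E; auto.
- intros ξ g; destruct (classic (exists t, fresh ξ g t)) as [[t Ht]|N].
  + exists t; split; [apply Ht|auto].
  + exists t0; split; [trivial|tauto].
- assert (I : forall A, (forall ξ, A ξ -> ξ ∈ κ) ->
    (forall ξ, A ξ -> exists t, fresh ξ g t) -> inj_on A g).
  { intros A AK HA x y Hx Hy E.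
    destruct (@ordinal_trichotomy x y) as [L|[|L]]; auto using mem_κ_ordinal; exfalso.
    - destruct (proj2 (Hg y) (HA y Hy)) as [_ N]; exact (N x L E).
    - destruct (proj2 (Hg x) (HA x Hx)) as [_ N]; exact (N y L (eq_sym E)). }
  destruct (classic (forall ξ, ξ ∈ κ -> exists t, fresh ξ g t)) as [A|N].
  { destruct (SP g); [intros x _; exact (proj1 (Hg x))|]; apply (I (El κ)); auto. }
  destruct (@mem_minimal (fun ξ => ξ ∈ κ /\ ~ exists t, fresh ξ g t))
    as [ξ [[Hξ Nξ] M]].
  { apply NNPP; intros N'; apply N; intros ξ Hξ; apply NNPP; intros Nξ.
    apply N'; eauto. }
  exists ξ, g; split; [|split; [|split]]; trivial.
  + intros η; exact (proj1 (Hg η)).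
  + apply I; [intros η Hη; exact (κ_trans Hξ Hη)|].
    intros η Hη; apply NNPP; intros Nη; apply (M η); trivial.
    split; trivial; exact (κ_trans Hξ Hη).
  + intros t Pt; apply NNPP; intros Nt; apply Nξ; exists t; split; trivial.
    intros η Hη E; apply Nt; eauto.
Qed.

(** Enumerate [P] in type [ξ ∈ κ] and let [d x y] be the first place at which the
    subsets with numbers [x] and [y] differ.  Colour the triples [x ∈ y ∈ z]
    according to whether [d x y ∈ d y z].  If this holds on a homogeneous set,
    the values of [d] at successive points of it embed it into [ξ].
    Otherwise [d y z] takes its least value whenever [y] is large enough,
    which is impossible as three subsets cannot pairwise differ at one place. *)
Lemma small_power T (P : T -> Prop) :
  small P -> small (fun q : T -> Prop => forall t, q t -> P t).
Proof.
intros SP F HF IF.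
destruct (classic (exists t, P t)) as [[t0 H0]|N].
2:{ destruct (κ_limit (ord_nat_κ 0)) as [γ [Hγ H]].
  assert (E : ord_nat 0 = γ); [|rewrite E in H; exact (mem_irrefl H)].
  apply IF; [apply ord_nat_κ|exact Hγ|].
  extensionality t; apply propositional_extensionality; split; intros K;
    destruct N; exists t; [exact (HF _ (ord_nat_κ 0) t K)|exact (HF γ Hγ t K)]. }
destruct (small_enumeration H0 SP) as [ξ [g [Hξ [Pg [_ Sg]]]]].
pose (differ x y η := η ∈ ξ /\ ~ (F x (g η) <-> F y (g η))).
pose (d x y := epsilon (inhabits ξ)
  (fun η => differ x y η /\ forall η', differ x y η' -> ~ η' ∈ η)).
assert (Hd : forall x y, x ∈ κ -> y ∈ κ -> x ∈ y ->
  differ x y (d x y) /\ forall η', differ x y η' -> ~ η' ∈ d x y).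
{ intros x y Hx Hy Hxy; unfold d; apply epsilon_spec, mem_minimal.
  apply NNPP; intros N; apply (@mem_irrefl x).
  enough (E : x = y) by (rewrite E at 2; exact Hxy).
  apply IF; trivial; extensionality t; apply propositional_extensionality.
  destruct (classic (P t)) as [Pt|NP].
  - destruct (Sg t Pt) as [η [Hη <-]]; apply NNPP; intros D.
    apply N; exists η; split; trivial.
  - split; intros K; destruct NP; [exact (HF x Hx t K)|exact (HF y Hy t K)]. }
destruct (homogeneous (fun l => exists x y z, l = [x; y; z] /\ d x y ∈ d y z))
  as [H [HH [LH Hom]]].
assert (ξord : forall η, η ∈ ξ -> ordinal η).
{ intros η Hη; apply mem_κ_ordinal; exact (κ_trans Hξ Hη). }
assert (S3 : forall x y z, x ∈ H -> y ∈ H -> z ∈ H -> x ∈ y -> y ∈ z ->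
  sorted [x; y; z] /\ forall w, In w [x; y; z] -> w ∈ H).
{ intros x y z Hx Hy Hz Hxy Hyz; split.
  - repeat constructor; trivial.
    apply (@ordinal_trans z x y); auto using mem_κ_ordinal.
  - intros w [<-|[<-|[<-|[]]]]; trivial. }
assert (next : forall x, x ∈ H -> exists y, y ∈ H /\ x ∈ y).
{ intros x Hx; apply large_unbounded; auto. }
destruct (classic (exists x y z, x ∈ H /\ y ∈ H /\ z ∈ H /\ x ∈ y /\ y ∈ z /\
  d x y ∈ d y z)) as [[a [b [c [Ha [Hb [Hc [Hab [Hbc E]]]]]]]]|N].
- assert (Inc : forall x y z, x ∈ H -> y ∈ H -> z ∈ H -> x ∈ y -> y ∈ z ->
    d x y ∈ d y z).
  { intros x y z Hx Hy Hz Hxy Hyz.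
    destruct (S3 a b c) as [S1 I1], (S3 x y z) as [S2 I2]; trivial.
    destruct (Hom [a; b; c] [x; y; z]) as [x' [y' [z' [E1 E2]]]]; eauto 6.
    injection E1 as -> -> ->; trivial. }
  pose (s x := epsilon (inhabits ξ) (fun y => (y ∈ H /\ x ∈ y) /\
    forall y', y' ∈ H /\ x ∈ y' -> ~ y' ∈ y)).
  assert (Hs : forall x, x ∈ H -> (s x ∈ H /\ x ∈ s x) /\
    forall y', y' ∈ H /\ x ∈ y' -> ~ y' ∈ s x).
  { intros x Hx; unfold s; apply epsilon_spec, mem_minimal; auto. }
  assert (K : forall x y, x ∈ H -> y ∈ H -> x ∈ y -> d x (s x) ∈ d y (s y)).
  { intros x y Hx Hy Hxy.
    destruct (Hs x Hx) as [[Hsx Lx] Mx], (Hs y Hy) as [[Hsy Ly] _].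
    destruct (@ordinal_trichotomy (s x) y) as [L|[E'|L]]; auto using mem_κ_ordinal.
    - apply ordinal_trans with (d (s x) y); auto.
      apply ξord, Hd; auto.
    - rewrite E' at 1; apply Inc; trivial.
    - destruct (Mx y); auto. }
  apply (@large_no_injection (El H) ξ (fun x => d x (s x)) LH Hξ).
  + intros x Hx; destruct (Hs x Hx) as [[Hsx Lx] _]; apply Hd; auto.
  + intros x y Hx Hy E'.
    destruct (@ordinal_trichotomy x y) as [L|[|L]]; auto using mem_κ_ordinal.
    * destruct (@mem_irrefl (d y (s y))); rewrite <- E' at 1; auto.
    * destruct (@mem_irrefl (d y (s y))); rewrite <- E' at 2; auto.
- destruct (@mem_minimal (fun e => exists x y, x ∈ H /\ y ∈ H /\ x ∈ y /\ e = d x y))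
    as [e [[x [y [Hx [Hy [Hxy Ee]]]]] M]].
  { destruct (large_not_sub LH (ord_nat_κ 0)) as [x [Hx _]].
    destruct (next x Hx) as [y [Hy Hxy]]; eauto 8. }
  assert (C : forall u v w, u ∈ H -> v ∈ H -> w ∈ H -> u ∈ v -> v ∈ w ->
    e = d u v -> e = d v w).
  { intros u v w Hu Hv Hw Huv Hvw Eu.
    destruct (@ordinal_trichotomy e (d v w)) as [L|[L|L]]; trivial.
    - rewrite Eu; apply ξord, Hd; auto.
    - apply ξord, Hd; auto.
    - destruct N; exists u, v, w; repeat split; trivial; now rewrite <- Eu.
    - destruct (M (d v w)); eauto 8. }
  destruct (next y Hy) as [z [Hz Hyz]], (next z Hz) as [w [Hw Hzw]].
  assert (Hyw : y ∈ w) by (apply (@ordinal_trans w y z); auto using mem_κ_ordinal).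
  destruct (Hd y z) as [[_ D1] _], (Hd z w) as [[_ D2] _],
    (Hd y w) as [[_ D3] _]; auto.
  rewrite <- (C x y z) in D1 by trivial.
  rewrite <- (C y z w) in D2 by (trivial; apply (C x y z); trivial).
  rewrite <- (C x y w) in D3 by trivial.
  tauto.
Qed.

(** ** Inaccessibility *)

(** If [f] were unbounded on [α], send [x] to some [ξ ∈ α] with [f ξ] not below
    [x].  This map is constant on an unbounded set of [x], with a value [ξ] such
    that [f ξ] is not below [κ]. *)
Lemma κ_regular : regular κ.
Proof.
intros α f Hα Hf; apply NNPP; intros N.
pose (p x := epsilon (inhabits α) (fun ξ => ξ ∈ α /\ ~ f ξ ∈ x)).
assert (Hp : forall x, x ∈ κ -> p x ∈ α /\ ~ f (p x) ∈ x).
{ intros x Hx; unfold p; apply epsilon_spec, NNPP; intros N'.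
  apply N; exists x; split; trivial; intros ξ Hξ; apply NNPP; intros Nξ.
  apply N'; eauto. }
destruct (small_constant (small_ordinal Hα) (F := p)) as [H [HH [LH C]]].
{ intros x Hx; now apply Hp. }
destruct (large_not_sub LH (ord_nat_κ 0)) as [a [Ha _]].
destruct (large_unbounded HH LH (Hf (p a) (proj1 (Hp a (HH a Ha))))) as [x [Hx L]].
apply (proj2 (Hp x (HH x Hx))); now rewrite (C x a).
Qed.

Lemma small_powerset α : α ∈ κ -> small (fun x => x ⊆ α).
Proof.
intros Hα; eapply small_inj with (f := El); [| |exact (small_power (small_ordinal Hα))].
- intros x Hx; exact Hx.
- intros x y _ _ E; apply V_ext; intros z; change (El x z <-> El y z); now rewrite E.
Qed.

Lemma κ_inaccessible : inaccessible κ.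
Proof.
split; [|split]; [split; [apply κ_cardinal|apply omega_κ] | apply κ_regular |].
intros lam Hlam _.
assert (L0 : lam ⊆ lam) by (intros z; auto).
destruct (@small_enumeration V (fun x => x ⊆ lam) lam L0 (small_powerset Hlam))
  as [ξ [g [Hξ [G1 [G2 G3]]]]].
assert (E : equipotent (fun x => x ⊆ lam) (El ξ)).
{ apply equipotent_sym; exists g; split; [|split]; auto. }
destruct (@mem_minimal (fun μ => μ ∈ κ /\ equipotent (fun x => x ⊆ lam) (El μ)))
  as [μ [[Hμ Eμ] M]]; eauto.
exists μ; split; [|split]; trivial; split; [now apply mem_κ_ordinal|].
intros α Hα Eα; apply (M α); trivial; split; [exact (κ_trans Hμ Hα)|].
apply equipotent_trans with (El μ); trivial; now apply equipotent_sym.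
Qed.

(** There are few possible ranks, and the sets of a fixed rank [ε] are subsets of
    [R ε], which is small by induction. *)
Lemma small_rank δ : δ ∈ κ -> small (R δ).
Proof.
induction (V_foundation δ) as [δ _ IH]; intros Hδ.
apply small_fibres with (Q := El δ) (f := rank); [now apply small_ordinal|trivial|].
intros ε Hε; eapply small_inj with (f := El);
  [| |exact (small_power (IH ε Hε (κ_trans Hδ Hε)))].
- intros x [_ <-] y Hy; now apply rank_mem.
- intros x y _ _ E; apply V_ext; intros z; change (El x z <-> El y z); now rewrite E.
Qed.

(** ** Small classes of trees *)

Inductive tree (L : Type) : Type :=
| Leaf (l : L)
| Node (a b : tree L).

Fixpoint depth (L : Type) (t : tree L) : nat :=
  match t with Leaf _ => 0 | Node a b => S (Nat.max (depth a) (depth b)) end.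

Fixpoint all_leaves (L : Type) (P : L -> Prop) (t : tree L) : Prop :=
  match t with Leaf l => P l | Node a b => all_leaves P a /\ all_leaves P b end.

Lemma small_tree L (P : L -> Prop) : small P -> small (all_leaves P).
Proof.
intros SP.
apply small_fibres with (Q := fun _ => True) (f := @depth L); trivial;
  [apply small_nat|]; intros n _.
apply small_mono with (fun t => all_leaves P t /\ depth t < S n);
  [intros t [H <-]; split; trivial; lia|].
generalize (S n); clear n; intros n; induction n as [|n IH].
- intros F HF; destruct (HF _ (ord_nat_κ 0)); lia.
- eapply small_mono; [|exact (small_or (small_image (f := @Leaf L) SP)
    (small_image (f := fun p => Node (fst p) (snd p)) (small_prod IH IH)))].
  intros [l|a b]; simpl; intros [H D]; [left; eauto|right].
  exists (a, b); simpl; intuition lia.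
Qed.

(** * Skolem terms *)

(** [Nil] and [Cons] build the finite lists of arguments of the Skolem functions;
    keeping them among the terms avoids a nested inductive type. *)
Inductive term (X : Type) : Type :=
| Var (x : X)
| Nil
| Cons (t s : term X)
| Skolem (φ : formula) (s : term X).
Arguments Nil {X}.

Fixpoint vars (X : Type) (t : term X) : list X :=
  match t with
  | Var x => [x]
  | Nil => []
  | Cons t s => vars t ++ vars s
  | Skolem _ s => vars s
  end.

Fixpoint rename (X Y : Type) (ρ : X -> Y) (t : term X) : term Y :=
  match t with
  | Var x => Var (ρ x)
  | Nil => Nil
  | Cons t s => Cons (rename ρ t) (rename ρ s)
  | Skolem φ s => Skolem φ (rename ρ s)
  end.

Lemma vars_rename X Y (ρ : X -> Y) t : vars (rename ρ t) = map ρ (vars t).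
Proof.
induction t as [x| |t IHt s IHs|φ s IH]; simpl; trivial.
now rewrite map_app, IHt, IHs.
Qed.

Fixpoint formula_tree (X : Type) (φ : formula) : tree (nat + X) :=
  let leaf n := Leaf (inl n) in
  match φ with
  | fEq i j => Node (leaf 0) (Node (leaf i) (leaf j))
  | fRel i j => Node (leaf 1) (Node (leaf i) (leaf j))
  | fPrd i => Node (leaf 2) (leaf i)
  | fNot φ => Node (leaf 3) (formula_tree X φ)
  | fAnd φ ψ => Node (leaf 4) (Node (formula_tree X φ) (formula_tree X ψ))
  | fEx φ => Node (leaf 5) (formula_tree X φ)
  end.

Fixpoint term_tree (X : Type) (t : term X) : tree (nat + X) :=
  match t with
  | Var x => Leaf (inr x)
  | Nil => Leaf (inl 0)
  | Cons t s => Node (Leaf (inl 0)) (Node (term_tree t) (term_tree s))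
  | Skolem φ s => Node (Leaf (inl 1)) (Node (formula_tree X φ) (term_tree s))
  end.

Lemma formula_tree_inj X φ ψ : formula_tree X φ = formula_tree X ψ -> φ = ψ.
Proof.
revert ψ; induction φ; intros []; simpl; intros E; inversion E; f_equal; auto.
Qed.

Lemma term_tree_inj X (t s : term X) : term_tree t = term_tree s -> t = s.
Proof.
revert s; induction t; intros []; simpl; intros E; inversion E; f_equal; auto.
eapply formula_tree_inj; eauto.
Qed.

Lemma small_terms X (P : X -> Prop) :
  small P -> small (fun t => forall x, In x (vars t) -> P x).
Proof.
intros SP.
pose (Q (l : nat + X) := match l with inl _ => True | inr x => P x end).
apply small_inj with (Q := all_leaves Q) (f := @term_tree X).
- assert (F : forall φ, all_leaves Q (formula_tree X φ))
    by (induction φ; simpl; tauto).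
  intros t; induction t as [x| |t IHt s IHs|φ s IH]; simpl; intros H; auto.
  repeat split; [apply IHt | apply IHs]; intros; apply H, in_app_iff; auto.
- intros t s _ _; apply term_tree_inj.
- apply small_tree.
  eapply small_mono;
    [|exact (small_or (small_image (f := inl) (small_nat (P := fun _ => True)))
               (small_image (f := inr) SP))].
  intros [n|x]; simpl; eauto.
Qed.

Section Evaluation.

Variable S : V.

Definition Vκ : structure := Structure (R κ) mem (El S).

(** The condition [R κ a] keeps the value in the structure when there is no witness. *)
Definition sk (φ : formula) (v : nat -> V) : V :=
  epsilon (inhabits (v 0)) (fun a =>
    R κ a /\ forall b, R κ b -> sat Vκ φ (scons b v) -> sat Vκ φ (scons a v)).

(** A term is evaluated to a sequence; the value proper is the entry at [0]. *)
Fixpoint ev (X : Type) (t : term X) (e : X -> V) : nat -> V :=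
  match t with
  | Var x => fun _ => e x
  | Nil => fun _ => ord_nat 0
  | Cons t s => scons (ev t e 0) (ev s e)
  | Skolem φ s => fun _ => sk φ (ev s e)
  end.

Lemma R_ordinal δ x : ordinal x -> x ∈ δ -> R δ x.
Proof. intros Hx H; unfold R; now rewrite rank_ordinal. Qed.

Lemma R_mem δ x y : ordinal δ -> x ∈ y -> R δ y -> R δ x.
Proof. intros Hδ Hx Hy; exact (ordinal_trans Hδ Hy (rank_mem Hx)). Qed.

Lemma R_empty : R κ (ord_nat 0).
Proof. apply R_ordinal; [apply mem_κ_ordinal|]; apply ord_nat_κ. Qed.

Lemma sk_spec φ v : R κ (sk φ v) /\
  forall b, R κ b -> sat Vκ φ (scons b v) -> sat Vκ φ (scons (sk φ v) v).
Proof.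
unfold sk; apply epsilon_spec.
destruct (classic (exists b, R κ b /\ sat Vκ φ (scons b v))) as [[b [Hb Sb]]|N].
- exists b; auto.
- exists (ord_nat 0); split; [apply R_empty|]; intros b Hb Sb; destruct N; eauto.
Qed.

Lemma ev_R X (t : term X) e :
  (forall x, In x (vars t) -> R κ (e x)) -> forall n, R κ (ev t e n).
Proof.
induction t as [x| |t IHt s IHs|φ s IH]; simpl; intros H n; auto.
- apply R_empty.
- destruct n; simpl; [apply IHt|apply IHs]; intros; apply H, in_app_iff; auto.
- apply sk_spec.
Qed.

Lemma ev_ext X (t : term X) e e' :
  (forall x, In x (vars t) -> e x = e' x) -> ev t e = ev t e'.
Proof.
induction t as [x| |t IHt s IHs|φ s IH]; simpl; intros H; trivial.
- now rewrite H by auto.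
- rewrite IHt, IHs; trivial; intros; apply H, in_app_iff; auto.
- now rewrite IH.
Qed.

Lemma ev_rename X Y (ρ : X -> Y) t e :
  ev (rename ρ t) e = ev t (fun x => e (ρ x)).
Proof.
induction t as [x| |t IHt s IHs|φ s IH]; simpl; trivial.
- now rewrite IHt, IHs.
- now rewrite IH.
Qed.

Fixpoint free_bound (φ : formula) : nat :=
  match φ with
  | fEq i j | fRel i j => Datatypes.S (Nat.max i j)
  | fPrd i => Datatypes.S i
  | fNot φ => free_bound φ
  | fAnd φ ψ => Nat.max (free_bound φ) (free_bound ψ)
  | fEx φ => free_bound φ
  end.

Lemma sat_ext A φ v v' : (forall n, n < free_bound φ -> v n = v' n) ->
  (sat A φ v <-> sat A φ v').
Proof.
revert v v'; induction φ as [i j|i j|i|φ IH|φ IHφ ψ IHψ|φ IH];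
  simpl; intros v v' H.
- rewrite (H i), (H j) by lia; tauto.
- rewrite (H i), (H j) by lia; tauto.
- rewrite (H i) by lia; tauto.
- rewrite (IH v v' H); tauto.
- rewrite (IHφ v v'), (IHψ v v'); [tauto| |]; intros n Hn; apply H; lia.
- assert (E : forall a, sat A φ (scons a v) <-> sat A φ (scons a v')).
  { intros a; apply IH; intros [|n] Hn; simpl; trivial; apply H; lia. }
  split; intros [a [Da Sa]]; exists a; split; trivial; now apply E.
Qed.

Fixpoint arguments (X : Type) (k : nat) (ts : nat -> term X) : term X :=
  match k with
  | 0 => Nil
  | Datatypes.S k => Cons (ts 0) (arguments k (fun n => ts (Datatypes.S n)))
  end.

Lemma vars_arguments X k (ts : nat -> term X) x :
  In x (vars (arguments k ts)) -> exists n, In x (vars (ts n)).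
Proof.
revert ts; induction k as [|k IH]; simpl; intros ts; [intros []|].
rewrite in_app_iff; intros [H|H]; [eauto|].
destruct (IH _ H) as [n Hn]; eauto.
Qed.

Lemma ev_arguments X k (ts : nat -> term X) e n :
  n < k -> ev (arguments k ts) e n = ev (ts n) e 0.
Proof.
revert ts n; induction k as [|k IH]; intros ts n Hn; [lia|].
destruct n as [|n]; simpl; trivial; apply (IH (fun n => ts (Datatypes.S n))); lia.
Qed.

Definition skolem (X : Type) (φ : formula) (ts : nat -> term X) : term X :=
  Skolem φ (arguments (free_bound φ) ts).

Lemma vars_skolem X φ (ts : nat -> term X) x :
  In x (vars (skolem φ ts)) -> exists n, In x (vars (ts n)).
Proof. apply vars_arguments. Qed.

Lemma skolem_spec X φ (ts : nat -> term X) e b : R κ b ->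
  sat Vκ φ (scons b (fun n => ev (ts n) e 0)) ->
  sat Vκ φ (scons (ev (skolem φ ts) e 0) (fun n => ev (ts n) e 0)).
Proof.
intros Hb Sb.
assert (K : forall a, sat Vκ φ (scons a (fun n => ev (ts n) e 0)) <->
  sat Vκ φ (scons a (ev (arguments (free_bound φ) ts) e))).
{ intros a; apply sat_ext; intros [|n] Hn; simpl; trivial.
  symmetry; apply ev_arguments; lia. }
apply K; simpl; apply (proj2 (sk_spec _ _)) with b; trivial; now apply K.
Qed.

(** * Indiscernibles *)

Definition assign (a : list V) (x : nat + V) : V :=
  match x with inl k => nth k a (ord_nat 0) | inr c => c end.

Definition parameters_in (γ : V) (x : nat + V) : Prop :=
  match x with inl _ => True | inr c => R γ c end.

Definition agree (γ : V) (a b : list V) : Prop :=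
  forall φ s, (forall x, In x (vars s) -> parameters_in γ x) ->
    (sat Vκ φ (ev s (assign a)) <-> sat Vκ φ (ev s (assign b))).

(** Colour [γ :: a ++ b] according to whether [a] and [b] have the same type over
    the parameters of rank below [γ].  There are fewer than [κ] such types,
    so among [κ] many blocks of a homogeneous set two have the same type,
    and hence any two successive blocks do; two arbitrary blocks are
    compared with a third one above both. *)
Lemma indiscernibles : exists H, H ⊆ κ /\ large (El H) /\
  forall γ a b, γ ∈ H -> sorted a -> sorted b -> length a = length b ->
    (forall x, In x a -> x ∈ H /\ γ ∈ x) -> (forall x, In x b -> x ∈ H /\ γ ∈ x) ->
    agree γ a b.
Proof.
destruct (homogeneous (fun l => exists γ a b,
  l = γ :: a ++ b /\ length a = length b /\ ~ agree γ a b)) as [H [HH [LH Hom]]].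
exists H; split; [|split]; trivial.
assert (Seq : forall γ a b, γ ∈ H -> sorted a -> sorted b ->
  (forall x, In x a -> x ∈ H /\ γ ∈ x) -> (forall x, In x b -> x ∈ H /\ γ ∈ x) ->
  (forall x y, In x a -> In y b -> x ∈ y) ->
  sorted (γ :: a ++ b) /\ forall x, In x (γ :: a ++ b) -> x ∈ H).
{ intros γ a b Hγ Sa Sb Ha Hb Hab; split.
  - constructor; [now apply sorted_app|].
    apply Forall_forall; intros x Hx; apply in_app_iff in Hx.
    destruct Hx as [Hx|Hx]; [now apply Ha|now apply Hb].
  - intros x [<-|Hx]; trivial; apply in_app_iff in Hx.
    destruct Hx as [Hx|Hx]; [now apply Ha|now apply Hb]. }
assert (Succ : forall γ a b, γ ∈ H -> sorted a -> sorted b -> length a = length b ->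
  (forall x, In x a -> x ∈ H /\ γ ∈ x) -> (forall x, In x b -> x ∈ H /\ γ ∈ x) ->
  (forall x y, In x a -> In y b -> x ∈ y) -> agree γ a b).
{ intros γ a b Hγ Sa Sb Lab Ha Hb Hab; apply NNPP; intros N.
  pose (B x := epsilon (inhabits a) (fun l => length l = length a /\ sorted l /\
    forall y, In y l -> y ∈ H /\ x ∈ y)).
  assert (HB : forall x, x ∈ κ -> length (B x) = length a /\ sorted (B x) /\
    forall y, In y (B x) -> y ∈ H /\ x ∈ y).
  { intros x Hx; unfold B; apply epsilon_spec; now apply (large_blocks (A := El H)). }
  pose (type x t := exists φ s, t = Skolem φ s /\
    (forall x, In x (vars s) -> parameters_in γ x) /\
    sat Vκ φ (ev s (assign (B x)))).
  assert (SP : small (parameters_in γ)).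
  { eapply small_mono;
      [|exact (small_or (small_image (f := inl) (small_nat (P := fun _ => True)))
         (small_image (f := inr) (small_rank (HH γ Hγ))))].
    intros [n|c]; simpl; eauto. }
  destruct (small_constant (small_power (small_terms SP)) (F := type))
    as [H' [HH' [LH' C]]].
  { intros x _ t [φ [s [-> [Hs _]]]]; exact Hs. }
  destruct (large_unbounded (A := El H') HH' LH' (HH γ Hγ)) as [x [Hx Hγx]].
  destruct (HB x (HH' x Hx)) as [Lx [Sx Bx]].
  destruct (list_bounded (l := B x)) as [β [Hβ Bβ]]; [intros y Hy; now apply HH, Bx|].
  destruct (max_κ Hβ (HH' x Hx)) as [δ [Hδ [D1 D2]]].
  destruct (large_unbounded (A := El H') HH' LH' Hδ) as [y [Hy Hδy]].
  destruct (HB y (HH' y Hy)) as [Ly [Sy By]].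
  assert (Oy : forall z, In z (B y) -> ordinal z)
    by (intros z Hz; apply mem_κ_ordinal, HH, By, Hz).
  assert (Up : forall u z, u ∈ δ -> In z (B y) -> u ∈ z).
  { intros u z Hu Hz; apply (@ordinal_trans z u y); auto; [apply By, Hz|].
    apply (@ordinal_trans y u δ); auto; apply mem_κ_ordinal, HH', Hy. }
  destruct (Seq γ a b) as [S1 I1]; trivial.
  destruct (Seq γ (B x) (B y)) as [S2 I2]; auto.
  { intros z Hz; destruct (Bx z Hz) as [K1 K2]; split; trivial.
    apply (@ordinal_trans z γ x); auto; apply mem_κ_ordinal; auto. }
  { intros z Hz; split; [now apply By|]; apply Up; auto. }
  destruct (Hom (γ :: a ++ b) (γ :: B x ++ B y)) as [γ' [a' [b' [E [L' N']]]]];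
    trivial.
  { simpl; rewrite !length_app; lia. }
  { exists γ, a, b; auto. }
  injection E as <- E.
  assert (length (B x) = length a').
  { apply (f_equal (@length V)) in E; rewrite !length_app in E; lia. }
  destruct (app_eq_length E) as [<- <-]; trivial.
  apply N'; intros φ s Hs.
  assert (K : forall x, sat Vκ φ (ev s (assign (B x))) <-> type x (Skolem φ s)).
  { intros z; split; [intros Sz; exists φ, s; auto|].
    intros [φ' [s' [E' [_ Sz]]]]; injection E' as -> ->; trivial. }
  rewrite !K, (C x y); tauto. }
intros γ a b Hγ Sa Sb Lab Ha Hb.
destruct (list_bounded (l := γ :: a ++ b)) as [β [Hβ B]].
{ intros x [<-|Hx]; [auto|]; apply in_app_iff in Hx.
  destruct Hx as [Hx|Hx]; apply HH; [now apply Ha|now apply Hb]. }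
destruct (large_blocks (A := El H) (length a) HH LH Hβ) as [c [Lc [Sc Hc]]].
assert (Up : forall x z, In x (γ :: a ++ b) -> In z c -> x ∈ z).
{ intros x z Hx Hz; apply (@ordinal_trans z x β); auto; [|now apply Hc].
  apply mem_κ_ordinal, HH, Hc, Hz. }
assert (Hc' : forall z, In z c -> z ∈ H /\ γ ∈ z).
{ intros z Hz; split; [now apply Hc|]; apply Up; trivial; now left. }
assert (Upa : forall x z, In x a -> In z c -> x ∈ z)
  by (intros x z Hx; apply Up; right; apply in_app_iff; auto).
assert (Upb : forall x z, In x b -> In z c -> x ∈ z)
  by (intros x z Hx; apply Up; right; apply in_app_iff; auto).
intros φ s Hs; transitivity (sat Vκ φ (ev s (assign c))).
- apply (Succ γ a c); auto.
- symmetry; apply (Succ γ b c); auto; congruence.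
Qed.

(** * The stretched model *)

Section Stretching.

Variable H : V.
Hypothesis H_κ : H ⊆ κ.
Hypothesis H_large : large (El H).
Hypothesis H_indiscernible : forall γ a b, γ ∈ H -> sorted a -> sorted b ->
  length a = length b ->
  (forall x, In x a -> x ∈ H /\ γ ∈ x) -> (forall x, In x b -> x ∈ H /\ γ ∈ x) ->
  agree γ a b.

Variable Rκ : V.
Hypothesis mem_Rκ : forall z, z ∈ Rκ <-> R κ z.

Variable lam : V.
Hypothesis lam_ordinal : ordinal lam.

(** The symbols are taken from index types of trees, and not from [V], so that the
    terms form a type small enough to index a tree, their collapse. *)
Definition symbol : Type := (idx (repr Rκ) + idx (repr lam))%type.

Definition const (c : idx (repr Rκ)) : V := cls (elt c).
Definition index (i : idx (repr lam)) : V := cls (elt i).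

Lemma const_R c : R κ (const c).
Proof. apply mem_Rκ, mem_idx; now exists c. Qed.

Lemma R_const x : R κ x -> exists c, x = const c.
Proof. intros Hx; now apply mem_Rκ, mem_idx in Hx. Qed.

Lemma index_ordinal i : ordinal (index i).
Proof. apply (ordinal_mem lam_ordinal), mem_idx; now exists i. Qed.

Definition value (g : V -> V) (x : symbol) : V :=
  match x with inl c => const c | inr i => g (index i) end.

(** Any two assignments that are good for the symbols of a formula agree on it, by
    indiscernibility. *)
Definition good (g : V -> V) (D : symbol -> Prop) : Prop :=
  (exists γ, γ ∈ H /\ forall x, D x ->
    match x with
    | inl c => R γ (const c)
    | inr i => g (index i) ∈ H /\ γ ∈ g (index i)
    end) /\
  forall i j, D (inr i) -> D (inr j) -> index i ∈ index j ->
    g (index i) ∈ g (index j).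

Definition over (D : symbol -> Prop) (t : term symbol) : Prop :=
  forall x, In x (vars t) -> D x.

Lemma good_mono g D D' : (forall x, D' x -> D x) -> good g D -> good g D'.
Proof.
intros HD [[γ [Hγ G]] M]; split; [|auto].
exists γ; split; trivial; intros x Hx; apply G; auto.
Qed.

Lemma countable_bounded (s : nat -> list V) :
  (forall n x, In x (s n) -> x ∈ κ) ->
  exists β, β ∈ κ /\ forall n x, In x (s n) -> x ∈ β.
Proof.
intros Hs.
pose (b n := epsilon (inhabits κ)
  (fun β => β ∈ κ /\ forall x, In x (s n) -> x ∈ β)).
assert (Hb : forall n, b n ∈ κ /\ forall x, In x (s n) -> x ∈ b n).
{ intros n; unfold b; apply epsilon_spec, list_bounded; eauto. }
pose (num ξ := epsilon (inhabits 0) (fun n => ξ = ord_nat n)).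
assert (Hnum : forall n, num (ord_nat n) = n).
{ intros n; apply ord_nat_inj; symmetry; unfold num; apply epsilon_spec; eauto. }
destruct (@κ_regular omega (fun ξ => b (num ξ)) omega_κ) as [β [Hβ B]].
{ intros ξ _; apply Hb. }
exists β; split; trivial; intros n x Hx.
apply (@ordinal_trans β x (b n)); [now apply mem_κ_ordinal| |now apply Hb].
rewrite <- (Hnum n); apply B, mem_omega; eauto.
Qed.

(** Since [κ] is regular and uncountable, even countably many index symbols can
    be sent to [H] in an increasing way, above countably many given ranks. *)
Lemma good_exists (ts : nat -> term symbol) :
  exists g D, good g D /\ forall n, over D (ts n).
Proof.
pose (D x := exists n, In x (vars (ts n))).
destruct (@countable_bounded (fun n => map (fun x : symbol =>
  match x with inl c => rank (const c) | inr _ => ord_nat 0 end) (vars (ts n))))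
  as [β [Hβ B]].
{ intros n x Hx; apply in_map_iff in Hx; destruct Hx as [[c|i] [<- _]];
    [apply const_R|apply ord_nat_κ]. }
destruct (large_unbounded (A := El H) H_κ H_large Hβ) as [γ [Hγ Hβγ]].
pose (fits ξ (g : V -> V) h := h ∈ H /\ γ ∈ h /\
  forall i, D (inr i) -> index i ∈ ξ -> g (index i) ∈ h).
destruct (@mem_recursion V γ
  (fun ξ g h => (exists h', fits ξ g h') -> fits ξ g h)) as [g Hg].
- intros ξ g g' h E K [h' [F1 [F2 F3]]]; destruct K as [K1 [K2 K3]].
  + exists h'; repeat split; trivial; intros i Di Hi; rewrite E; auto.
  + repeat split; trivial; intros i Di Hi; rewrite <- E; auto.
- intros ξ g; destruct (classic (exists h, fits ξ g h)) as [[h Hh]|N];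
    [exists h; auto|exists γ; tauto].
- assert (F : forall ξ, fits ξ g (g ξ)).
  { intros ξ; induction (V_foundation ξ) as [ξ _ IH]; apply Hg.
    pose (p (x : symbol) := match x with
      | inl _ => ord_nat 0
      | inr i => if excluded_middle_informative (index i ∈ ξ)
                 then g (index i) else ord_nat 0
      end).
    destruct (@countable_bounded (fun n => map p (vars (ts n)))) as [δ [Hδ B']].
    { intros n x Hx; apply in_map_iff in Hx; destruct Hx as [[c|i] [<- _]]; simpl;
        [apply ord_nat_κ|].
      destruct (excluded_middle_informative (index i ∈ ξ)) as [Hi|];
        [apply H_κ, (IH _ Hi)|apply ord_nat_κ]. }
    destruct (max_κ Hδ (H_κ Hγ)) as [ε [Hε [E1 E2]]].
    destruct (κ_limit Hε) as [ε' [Hε' Lε]].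
    assert (γord : ordinal γ) by now apply mem_κ_ordinal, H_κ.
    assert (Hγε : γ ∈ ε').
    { destruct (ordinal_sub γord (mem_κ_ordinal Hε)) as [K| ->]; trivial.
      exact (ordinal_trans (mem_κ_ordinal Hε') Lε K). }
    destruct (large_unbounded (A := El H) H_κ H_large Hε') as [h [Hh Lh]].
    assert (hord : ordinal h) by now apply mem_κ_ordinal, H_κ.
    exists h; repeat split; trivial; [exact (ordinal_trans hord Lh Hγε)|].
    intros i [n Di] Hi; apply (ordinal_trans hord Lh).
    apply (ordinal_trans (mem_κ_ordinal Hε') Lε), E1, (B' n).
    apply in_map_iff; exists (inr i); split; trivial; simpl.
    now destruct (excluded_middle_informative (index i ∈ ξ)). }
  exists g, D; split; [split|intros n x Hx; now exists n].
  + exists γ; split; trivial; intros [c|i] Dx.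
    * apply (@ordinal_trans γ (rank (const c)) β); trivial;
        [now apply mem_κ_ordinal, H_κ|].
      destruct Dx as [n Hn]; apply (B n), in_map_iff; now exists (inl c).
    * split; apply (F (index i)).
  + intros i j Di Dj Hij; now apply (F (index j)).
Qed.

(** The smaller of the two bounds serves both assignments.  Replacing the index
    symbols by their positions in an increasing list turns the assignments into
    two increasing blocks of [H], and the constants into parameters. *)
Lemma good_agree φ s g g' :
  good g (fun x => In x (vars s)) -> good g' (fun x => In x (vars s)) ->
  sat Vκ φ (ev s (value g)) -> sat Vκ φ (ev s (value g')).
Proof.
intros [[γ [Hγ G]] M] [[γ' [Hγ' G']] M'].
assert (K : exists δ, δ ∈ H /\ forall x, In x (vars s) ->
  match x with
  | inl c => R δ (const c)
  | inr i => (g (index i) ∈ H /\ δ ∈ g (index i)) /\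
             (g' (index i) ∈ H /\ δ ∈ g' (index i))
  end).
{ destruct (@ordinal_trichotomy γ γ') as [L|[<-|L]]; auto using mem_κ_ordinal.
  - exists γ; split; trivial; intros x Hx; specialize (G x Hx); specialize (G' x Hx).
    destruct x as [c|i]; trivial; repeat split; try tauto.
    apply (@ordinal_trans (g' (index i)) γ γ'); trivial; try tauto.
    apply mem_κ_ordinal, H_κ, G'.
  - exists γ; split; trivial; intros x Hx; specialize (G x Hx); specialize (G' x Hx).
    destruct x as [c|i]; tauto.
  - exists γ'; split; trivial; intros x Hx; specialize (G x Hx); specialize (G' x Hx).
    destruct x as [c|i]; trivial; repeat split; try tauto.
    apply (@ordinal_trans (g (index i)) γ' γ); trivial; try tauto.
    apply mem_κ_ordinal, H_κ, G. }
clear γ γ' Hγ Hγ' G G'; destruct K as [δ [Hδ K]].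
destruct (@sorted_enum (flat_map (fun x : symbol =>
  match x with inl _ => [] | inr i => [index i] end) (vars s))) as [l [Sl Ml]].
{ intros x Hx; apply in_flat_map in Hx; destruct Hx as [[c|i] [_ Hx]];
    [destruct Hx|destruct Hx as [<-|[]]; apply index_ordinal]. }
assert (Hl : forall x, In x l <-> exists i, In (inr i) (vars s) /\ x = index i).
{ intros x; rewrite Ml, in_flat_map; split.
  - intros [[c|i] [Hi Hx]]; [destruct Hx|destruct Hx as [<-|[]]; eauto].
  - intros [i [Hi ->]]; exists (inr i); simpl; auto. }
pose (position x := epsilon (inhabits 0)
  (fun k => k < length l /\ nth k l (ord_nat 0) = x)).
assert (Hp : forall f i, In (inr i) (vars s) ->
  nth (position (index i)) (map f l) (ord_nat 0) = f (index i)).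
{ intros f i Hi.
  assert (K' : position (index i) < length l /\
    nth (position (index i)) l (ord_nat 0) = index i).
  { unfold position; apply epsilon_spec, In_nth, Hl; eauto. }
  destruct K' as [K1 K2].
  rewrite (nth_indep _ _ (f (ord_nat 0))) by now rewrite length_map.
  now rewrite map_nth, K2. }
pose (ρ (x : symbol) := match x with
  | inl c => inr (const c)
  | inr i => inl (position (index i))
  end).
assert (Hρ : forall f, ev (rename ρ s) (assign (map f l)) = ev s (value f)).
{ intros f; rewrite ev_rename; apply ev_ext; intros [c|i] Hx; simpl; trivial.
  now apply Hp. }
rewrite <- (Hρ g), <- (Hρ g'); apply (H_indiscernible Hδ).
- apply sorted_map; trivial; intros x y Hx Hy.
  apply Hl in Hx, Hy; destruct Hx as [i [Hi ->]], Hy as [j [Hj ->]]; auto.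
- apply sorted_map; trivial; intros x y Hx Hy.
  apply Hl in Hx, Hy; destruct Hx as [i [Hi ->]], Hy as [j [Hj ->]]; auto.
- now rewrite !length_map.
- intros x Hx; apply in_map_iff in Hx; destruct Hx as [y [<- Hy]].
  apply Hl in Hy; destruct Hy as [i [Hi ->]]; apply (K _ Hi).
- intros x Hx; apply in_map_iff in Hx; destruct Hx as [y [<- Hy]].
  apply Hl in Hy; destruct Hy as [i [Hi ->]]; apply (K _ Hi).
- intros x Hx; rewrite vars_rename in Hx; apply in_map_iff in Hx.
  destruct Hx as [[c|i] [<- Hx]]; simpl; trivial; apply (K _ Hx).
Qed.

Definition holds (φ : formula) (s : term symbol) : Prop :=
  exists g, good g (fun x => In x (vars s)) /\ sat Vκ φ (ev s (value g)).

Lemma holds_iff φ s g D : good g D -> over D s ->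
  (holds φ s <-> sat Vκ φ (ev s (value g))).
Proof.
intros Hg Hs; pose proof (good_mono (D' := fun x => In x (vars s)) Hs Hg) as Hg'.
split; [|exists g; auto].
intros [g' [G' S']]; exact (good_agree G' Hg' S').
Qed.

Definition tval (g : V -> V) (t : term symbol) : V := ev t (value g) 0.

Definition memt (s t : term symbol) : Prop := holds (fRel 0 1) (Cons s (Cons t Nil)).
Definition prdt (t : term symbol) : Prop := holds (fPrd 0) t.

Lemma memt_iff s t g D : good g D -> over D s -> over D t ->
  (memt s t <-> tval g s ∈ tval g t).
Proof.
intros Hg Hs Ht; apply (holds_iff (fRel 0 1) (s := Cons s (Cons t Nil)) Hg).
intros x; simpl; rewrite !in_app_iff; simpl; intros [Hx|[Hx|[]]]; auto.
Qed.

Lemma prdt_iff t g D : good g D -> over D t -> (prdt t <-> tval g t ∈ S).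
Proof. exact (@holds_iff (fPrd 0) t g D). Qed.

Lemma tval_R t g D : good g D -> over D t -> R κ (tval g t).
Proof.
intros [[γ [_ G]] _] Ht; apply ev_R; intros [c|i] Hx; simpl; [apply const_R|].
destruct (G _ (Ht _ Hx)) as [K _]; apply H_κ in K.
apply R_ordinal; trivial; now apply mem_κ_ordinal.
Qed.

(** The terms of a descending sequence contain only countably many symbols, so
    that a single assignment turns it into a descending sequence of sets. *)
Lemma memt_wf : well_founded memt.
Proof.
intros t; apply NNPP; intros Nt.
pose (next s := epsilon (inhabits t) (fun r => memt r s /\ ~ Acc memt r)).
assert (Hnext : forall s, ~ Acc memt s -> memt (next s) s /\ ~ Acc memt (next s)).
{ intros s Ns; unfold next; apply epsilon_spec, NNPP; intros N; apply Ns.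
  constructor; intros r Hr; apply NNPP; intros Nr; apply N; eauto. }
pose (ts n := Nat.iter n next t).
assert (Hts : forall n, ~ Acc memt (ts n))
  by (induction n as [|n IH]; simpl; trivial; now apply Hnext).
destruct (good_exists ts) as [g [D [Hg HD]]].
destruct (@mem_minimal (fun x => exists n, x = tval g (ts n))) as [x [[n ->] M]];
  [exists (tval g t), 0; trivial|].
apply (M (tval g (ts (Datatypes.S n)))); [eauto|].
apply (memt_iff Hg); trivial; simpl; now apply Hnext.
Qed.

(** ** The transitive collapse *)

Definition collE : term symbol -> Ens :=
  Fix memt_wf (fun _ => Ens)
    (fun t rec => sup (fun p : {s | memt s t} => rec (proj1_sig p) (proj2_sig p))).

Definition coll (t : term symbol) : V := cls (collE t).

Lemma mem_coll z t : z ∈ coll t <-> exists s, memt s t /\ z = coll s.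
Proof.
unfold coll at 1, collE; rewrite Fix_eq.
- rewrite mem_cls; simpl; split.
  + intros [[s Hs] ->]; exists s; auto.
  + intros [s [Hs ->]]; now exists (exist _ s Hs).
- intros x f f' E; f_equal; extensionality p; apply E.
Qed.

Lemma good_exists3 r s t :
  exists g D, good g D /\ over D r /\ over D s /\ over D t.
Proof.
destruct (good_exists (fun n => nth n [r; s; t] Nil)) as [g [D [Hg HD]]].
exists g, D; exact (conj Hg (conj (HD 0) (conj (HD 1) (HD 2)))).
Qed.

Lemma good_indep s t g D g' D' : good g D -> over D s -> over D t ->
  good g' D' -> over D' s -> over D' t ->
  tval g s = tval g t -> tval g' s = tval g' t.
Proof.
intros Hg Hs Ht Hg' Hs' Ht' E.
assert (K : forall B, over B s -> over B t -> over B (Cons s (Cons t Nil))).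
{ intros B K1 K2 x; simpl; rewrite !in_app_iff; simpl; intros [Hx|[Hx|[]]]; auto. }
apply (holds_iff (fEq 0 1) Hg' (K D' Hs' Ht')).
now apply (holds_iff (fEq 0 1) Hg (K D Hs Ht)).
Qed.

(** If the values of two terms differed, a Skolem term would name an element of one
    value outside the other.  Its collapse lies in both collapses, hence is
    the collapse of a member of the second term, and by induction that member
    has the same value as the Skolem term. *)
Lemma coll_inj s t g D : good g D -> over D s -> over D t ->
  coll s = coll t -> tval g s = tval g t.
Proof.
revert t g D; induction (memt_wf s) as [s _ IH]; intros t g D Hg Hs Ht E.
apply V_ext; intros z; apply NNPP; intros N.
assert (K : forall a b, over D a -> over D b -> z ∈ tval g a -> ~ z ∈ tval g b ->
  exists r, over D r /\ memt r a /\ ~ memt r b).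
{ intros a b Ha Hb Za Zb.
  pose (ts n := nth n [a; b] Nil).
  pose (φ := fAnd (fRel 0 1) (fNot (fRel 0 2))).
  assert (Hr : over D (skolem φ ts)).
  { intros x Hx; apply vars_skolem in Hx; destruct Hx as [[|[|[|n]]] Hx];
      [apply Ha, Hx|apply Hb, Hx|destruct Hx..]. }
  destruct (@skolem_spec symbol φ ts (value g) z) as [K1 K2].
  - apply (R_mem κ_ordinal Za), (tval_R Hg Ha).
  - split; trivial.
  - exists (skolem φ ts); split; [trivial|split].
    + now apply (memt_iff Hg Hr Ha).
    + intros M; apply K2; now apply (memt_iff Hg Hr Hb). }
assert (Step : forall r, memt r s -> forall r', coll r = coll r' -> forall u,
  memt r u <-> memt r' u).
{ intros r Hr r' E' u; destruct (good_exists3 r r' u) as [g' [D' [G [O1 [O2 O3]]]]].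
  rewrite (memt_iff G O1 O3), (memt_iff G O2 O3), (IH r Hr r' g' D' G O1 O2 E').
  tauto. }
destruct (classic (z ∈ tval g s)) as [Zs|Zs], (classic (z ∈ tval g t)) as [Zt|Zt];
  try tauto.
- destruct (K s t) as [r [_ [R1 R2]]]; trivial.
  assert (M : coll r ∈ coll t) by (rewrite <- E; apply mem_coll; eauto).
  apply mem_coll in M; destruct M as [r' [M1 M2]]; apply R2.
  now apply (Step r R1 r' M2).
- destruct (K t s) as [r [_ [R1 R2]]]; trivial.
  assert (M : coll r ∈ coll s) by (rewrite E; apply mem_coll; eauto).
  apply mem_coll in M; destruct M as [r' [M1 M2]]; apply R2.
  now apply (Step r' M1 r (eq_sym M2)).
Qed.

Lemma coll_eq s t g D : good g D -> over D s -> over D t ->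
  tval g s = tval g t -> coll s = coll t.
Proof.
intros Hg Hs Ht E; apply V_ext; intros z; rewrite !mem_coll.
enough (K : forall r, memt r s <-> memt r t)
  by (split; intros [r [Hr ->]]; exists r; split; trivial; now apply K).
intros r; destruct (good_exists3 r s t) as [g' [D' [G [O1 [O2 O3]]]]].
rewrite (memt_iff G O1 O2), (memt_iff G O1 O3).
now rewrite (good_indep Hg Hs Ht G O2 O3 E).
Qed.

Lemma coll_mem s t g D : good g D -> over D s -> over D t ->
  (coll s ∈ coll t <-> tval g s ∈ tval g t).
Proof.
intros Hg Hs Ht; rewrite <- (memt_iff Hg Hs Ht), mem_coll; split; [|eauto].
intros [r [Hr E]]; destruct (good_exists3 r s t) as [g' [D' [G [O1 [O2 O3]]]]].
apply (memt_iff G O2 O3); rewrite (coll_inj G O2 O1 E).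
now apply (memt_iff G O1 O3).
Qed.

(** The collapse, and not the class of terms, is used as the model because an
    extension has to contain [R κ] literally. *)
Definition M : structure :=
  Structure (fun z => exists t, z = coll t) mem
    (fun z => exists t, z = coll t /\ prdt t).

Definition tcons (t : term symbol) (ts : nat -> term symbol) (n : nat) : term symbol :=
  match n with 0 => t | Datatypes.S n => ts n end.

Lemma scons_tcons (f : term symbol -> V) t ts :
  scons (f t) (fun n => f (ts n)) = fun n => f (tcons t ts n).
Proof. extensionality n; now destruct n. Qed.

(** A witness for an existential formula may be a term with symbols for which [g]
    is not good.  It is replaced by a Skolem term, which has no symbols
    besides those of [ts] and so may be evaluated at [g]. *)
Lemma los φ ts g D : good g D -> (forall n, over D (ts n)) ->
  (sat M φ (fun n => coll (ts n)) <-> sat Vκ φ (fun n => tval g (ts n))).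
Proof.
revert ts g D; induction φ as [i j|i j|i|φ IH|φ IHφ ψ IHψ|φ IH];
  intros ts g D Hg HD; simpl.
- split; [apply (coll_inj Hg)|apply (coll_eq Hg)]; trivial.
- apply (coll_mem Hg); trivial.
- unfold El; rewrite <- (prdt_iff Hg (HD i)); split; [|eauto].
  intros [t [E Ht]]; destruct (good_exists3 t (ts i) t) as [g' [D' [G [O1 [O2 _]]]]].
  apply (prdt_iff G O2); rewrite (coll_inj G O2 O1 E); now apply (prdt_iff G O1).
- now rewrite (IH ts g D).
- now rewrite (IHφ ts g D), (IHψ ts g D).
- assert (Step : forall t g' D', good g' D' -> (forall n, over D' (ts n)) -> over D' t ->
    (sat M φ (scons (coll t) (fun n => coll (ts n))) <->
     sat Vκ φ (scons (tval g' t) (fun n => tval g' (ts n))))).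
  { intros t g' D' G O Ot; rewrite (scons_tcons coll), (scons_tcons (tval g')).
    apply IH with D'; trivial; intros [|n]; simpl; auto. }
  assert (Osk : forall D', (forall n, over D' (ts n)) -> over D' (skolem φ ts)).
  { intros D' O x Hx; apply vars_skolem in Hx; destruct Hx as [n Hx].
    exact (O n x Hx). }
  split.
  + intros [a [[t ->] Sa]].
    destruct (good_exists (tcons t ts)) as [g' [D' [G O]]].
    assert (O' : forall n, over D' (ts n)) by exact (fun n => O (Datatypes.S n)).
    apply (Step t g' D' G O' (O 0)) in Sa.
    apply skolem_spec in Sa; [|exact (tval_R G (O 0))].
    apply (Step (skolem φ ts) g' D' G O' (Osk D' O')) in Sa.
    exists (tval g (skolem φ ts)); split; [exact (tval_R Hg (Osk D HD))|].
    now apply (Step (skolem φ ts) g D Hg HD (Osk D HD)).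
  + intros [a [Ha Sa]]; apply skolem_spec in Sa; trivial.
    exists (coll (skolem φ ts)); split; [now exists (skolem φ ts)|].
    now apply (Step (skolem φ ts) g D Hg HD (Osk D HD)).
Qed.

(** A term whose value is an element of [const c] takes a value [const c'],
    and by indiscernibility it is then equal to [c'] in the model: no set of
    [R κ] acquires new elements. *)
Lemma coll_const c : coll (Var (inl c)) = const c.
Proof.
remember (const c) as x eqn:E; revert c E.
induction (V_foundation x) as [x _ IH]; intros c ->.
apply V_ext; intros z; rewrite mem_coll; split.
- intros [s [Hs ->]].
  destruct (good_exists3 s (Var (inl c)) Nil) as [g [D [G [O1 [O2 _]]]]].
  apply (memt_iff G O1 O2) in Hs; change (tval g (Var (inl c))) with (const c) in Hs.
  destruct (@R_const (tval g s)) as [c' Ec]; [exact (tval_R G O1)|].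
  assert (K : coll s = const c').
  { rewrite <- (IH (const c')) with c'; trivial; [|now rewrite <- Ec].
    destruct (good_exists3 s (Var (inl c')) (Var (inl c)))
      as [g' [D' [G' [O1' [O2' O3']]]]].
    (* An assignment good for [s] and [c] remains good for [c'], of smaller rank. *)
    pose (D'' y := In y (vars s) \/ y = inl c').
    apply coll_eq with g D''.
    - destruct G as [[γ [Hγ G1]] G2]; split.
      + exists γ; split; trivial; intros y [Hy| ->]; [now apply G1, O1|].
        apply R_mem with (const c); [now apply mem_κ_ordinal, H_κ| |].
        * now rewrite <- Ec.
        * apply (G1 (inl c)), O2; now left.
      + intros i j [Hi|Hi] [Hj|Hj]; try discriminate; apply G2; now apply O1.
    - intros y Hy; now left.
    - intros y [<-|[]]; now right.
    - exact Ec. }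
  rewrite K, <- Ec; trivial.
- intros Hz; destruct (@R_const z) as [c' ->].
  { exact (R_mem κ_ordinal Hz (const_R c)). }
  exists (Var (inl c')); split; [|symmetry; now apply (IH (const c'))].
  destruct (good_exists3 (Var (inl c')) (Var (inl c)) Nil) as [g [D [G [O1 [O2 _]]]]].
  now apply (memt_iff G O1 O2).
Qed.

(** For a proper extension one index symbol is enough: its value lies above the rank
    of any given constant, so it differs from all constants.  New elements of
    old sets are excluded since both the model and [R κ] are transitive. *)
Lemma M_eee : lam <> ord_nat 0 -> eee Vκ M.
Proof.
intros Hlam.
assert (Sub : forall a, R κ a -> exists c, a = coll (Var (inl c))).
{ intros a Ha; destruct (R_const Ha) as [c ->]; exists c; now rewrite coll_const. }
split; [split|split].
- intros a Ha; destruct (Sub a Ha) as [c ->]; simpl; eauto.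
- intros φ v Hv.
  pose (c n := epsilon (inhabits (Nil : term symbol)) (fun t : term symbol => exists c, t = Var (inl c) /\ v n = const c)).
  assert (Hc : forall n, exists d, c n = Var (inl d) /\ v n = const d).
  { intros n; unfold c; apply epsilon_spec.
    destruct (R_const (Hv n)) as [d Hd]; eauto. }
  destruct (good_exists c) as [g [D [G O]]].
  pose proof (los φ G O) as L.
  assert (v = fun n => coll (c n)) as E1.
  { extensionality n; destruct (Hc n) as [d [-> ->]]; now rewrite coll_const. }
  assert (v = fun n => tval g (c n)) as E2.
  { extensionality n; now destruct (Hc n) as [d [-> ->]]. }
  rewrite <- E1, <- E2 in L; now symmetry.
- assert (exists i : idx (repr lam), True) as [i _].
  { apply NNPP; intros N; apply Hlam, V_ext; intros z; split; intros Hz.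
    - apply mem_idx in Hz; destruct Hz as [i _]; destruct N; eauto.
    - apply mem_ord_nat in Hz; destruct Hz as [m [Hm _]]; lia. }
  exists (coll (Var (inr i))); split; [simpl; eauto|]; intros Hi.
  destruct (Sub _ Hi) as [c E].
  destruct (good_exists3 (Var (inr i)) (Var (inl c)) Nil) as [g [D [G [O1 [O2 _]]]]].
  pose proof (coll_inj G O1 O2 E) as E'; unfold tval in E'; simpl in E'.
  destruct G as [[γ [Hγ G]] _].
  assert (K1 : R γ (const c)) by (apply (G (inl c)), O2; now left).
  destruct (G (inr i)) as [K2 K3]; [apply O1; now left|].
  rewrite <- E' in K1; unfold R in K1.
  rewrite rank_ordinal in K1 by now apply mem_κ_ordinal, H_κ.
  exact (mem_asym K1 K3).
- intros a Ha b; simpl; split.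
  + intros [Hb Hba]; destruct (Sub b Hb) as [c ->]; eauto.
  + intros [_ Hba]; split; trivial; exact (R_mem κ_ordinal Hba Ha).
Qed.

(** The collapse of an index term is an ordinal, since the values of its
    elements are ordinals below [κ]. *)
Lemma coll_index_ordinal i : ordinal (coll (Var (inr i))).
Proof.
assert (Val : forall g D, good g D -> over D (Var (inr i)) ->
  ordinal (tval g (Var (inr i)))).
{ intros g D [[γ [_ G]] _] O; apply mem_κ_ordinal, H_κ, (G (inr i)), O; now left. }
split.
- intros y Hy z Hz; apply mem_coll in Hy; destruct Hy as [s [Hs ->]].
  apply mem_coll in Hz; destruct Hz as [r [Hr ->]].
  destruct (good_exists3 r s (Var (inr i))) as [g [D [G [O1 [O2 O3]]]]].
  apply (coll_mem G O1 O3); apply (memt_iff G O1 O2) in Hr.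
  apply (memt_iff G O2 O3) in Hs; exact (ordinal_trans (Val g D G O3) Hs Hr).
- intros x y Hx Hy; apply mem_coll in Hx, Hy.
  destruct Hx as [r [Hr ->]], Hy as [s [Hs ->]].
  destruct (good_exists3 r s (Var (inr i))) as [g [D [G [O1 [O2 O3]]]]].
  rewrite (coll_mem G O1 O2), (coll_mem G O2 O1).
  apply (memt_iff G O1 O3) in Hr; apply (memt_iff G O2 O3) in Hs.
  destruct (proj2 (Val g D G O3) _ _ Hr Hs) as [K|[K|K]]; auto.
  right; left; exact (coll_eq G O1 O2 K).
Qed.

(** The collapses of the index terms increase with the index, and an increasing
    map of ordinals takes no element to a smaller one. *)
Lemma index_below_coll i : index i ∈ coll (Var (inr i)) \/ index i = coll (Var (inr i)).
Proof.
remember (index i) as ξ eqn:E; revert i E.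
induction (V_foundation ξ) as [ξ _ IH]; intros i ->.
apply ordinal_sub; [apply index_ordinal|apply coll_index_ordinal|].
intros η Hη.
assert (Hlam : η ∈ lam).
{ apply (ordinal_trans lam_ordinal (y := index i)); trivial.
  apply mem_idx; now exists i. }
apply mem_idx in Hlam; destruct Hlam as [j ->].
assert (K : coll (Var (inr j)) ∈ coll (Var (inr i))).
{ destruct (good_exists3 (Var (inr j)) (Var (inr i)) Nil) as [g [D [G [O1 [O2 _]]]]].
  apply (coll_mem G O1 O2); apply G; trivial; [apply O1|apply O2]; now left. }
destruct (IH (index j) Hη j eq_refl) as [L|L]; change (cls (elt j)) with (index j).
- exact (ordinal_trans (coll_index_ordinal i) K L).
- now rewrite L.
Qed.

Lemma M_set : is_set (dom M).
Proof. apply (V_small collE). Qed.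

Lemma M_wf : wf_structure M.
Proof.
intros a; induction (V_foundation a) as [a _ IH]; constructor.
intros b [_ [_ Hb]]; auto.
Qed.

Lemma M_trans x y : dom M x -> y ∈ x -> dom M y.
Proof.
intros [t ->] Hy; apply mem_coll in Hy; destruct Hy as [s [_ ->]]; now exists s.
Qed.

Lemma M_height : exists θ, height M θ /\ lam ⊆ θ.
Proof.
destruct M_set as [X HX]; destruct (V_separation ordinal X) as [θ Hθ].
exists θ; split.
- (* The model is a transitive class, so it is its own collapse. *)
  exists id; split.
  + intros a Ha z; unfold id; split.
    * intros Hz; exists z; split; [exact (M_trans Ha Hz)|auto].
    * intros [b [_ [Hb ->]]]; exact Hb.
  + intros z; rewrite Hθ, HX; unfold id; split.
    * intros [Hz Oz]; eauto.
    * intros [Oz [a [Ha ->]]]; auto.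
- intros ξ Hξ; apply Hθ; pose proof Hξ as Hi; apply mem_idx in Hi.
  destruct Hi as [i Ei].
  split; [apply HX|exact (ordinal_mem lam_ordinal Hξ)].
  change (ξ = index i) in Ei; rewrite Ei.
  assert (K : dom M (coll (Var (inr i)))) by (simpl; eauto).
  destruct (index_below_coll i) as [L|L]; [exact (M_trans K L)|now rewrite L].
Qed.

End Stretching.
End Evaluation.
End Ramsey.

Theorem theorem1p5 (κ : V) : ramsey κ -> unfoldable κ.
Proof.
intros Hκ; split; [exact (κ_inaccessible Hκ)|]; intros α S Hα _.
destruct (indiscernibles Hκ S) as [H [H1 [H2 H3]]].
destruct (R_is_set κ) as [Rκ HR].
(* The successor makes the set of index symbols nonempty also for [α] empty. *)
pose (lam := cls (succE (repr α))).
assert (Hlam : forall z, z ∈ lam <-> z ∈ α \/ z = α)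
  by (intros z; unfold lam; now rewrite mem_succE, cls_repr).
assert (Olam : ordinal lam).
{ split.
  - intros y Hy z Hz; apply Hlam; apply Hlam in Hy; left.
    destruct Hy as [Hy| ->]; trivial; exact (ordinal_trans Hα Hy Hz).
  - intros x y Hx Hy; apply Hlam in Hx, Hy; apply ordinal_trichotomy.
    + destruct Hx as [Hx| ->]; trivial; exact (ordinal_mem Hα Hx).
    + destruct Hy as [Hy| ->]; trivial; exact (ordinal_mem Hα Hy). }
pose (N := M Hκ H1 H2 H3 HR Olam).
assert (α ∈ lam) as Lα by (apply Hlam; auto).
exists N; split; [apply M_set|split; [apply M_wf|split; [apply M_eee|]]].
- intros E; rewrite E in Lα; apply mem_ord_nat in Lα; destruct Lα as [m [Hm _]]; lia.
- destruct (M_height Hκ H1 H2 H3 HR Olam) as [θ [Hθ K]].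
  exists θ; split; trivial; intros z Hz; apply K, Hlam; auto.
Qed.
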